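(* Let $1\le p<\infty$, $\varrho\in[1,2)$ and $\alpha\in(\frac14,\frac1{2\varrho})$. Let $X=(X^1,\dots,X^d)$ be a $d$-dimensional continuous, centred Gaussian process on $[0,T]$ with independent components, defined on a probability space $(\Omega,\mathcal F,\mathbb P)$, with $X_0=0$, such that for some $M<\infty$, for every $i\in\{1,\ldots,d\}$ and all $0\le s\le t\le T$, $$\|R_{X^i}\|_{\varrho;[s,t]^2}\le M|t-s|^{1/\varrho}.$$ Let $X^{\pi_n}$ denote the piecewise linear interpolation of $X$ along $\pi_n$, where $(\pi_n)_{n\in\mathbb{N}}$ is a nested sequence of partitions of $[0,T]$ with mesh $|\pi_n|\to0$. Set $\widehat X_t:=(t,X_t)$ and $\widehat X^{\pi_n}_t:=(t,X^{\pi_n}_t)$, $t\in[0,T]$. (i) Let $f\colon C([0,T];\mathbb{R}^{d+1})\to\mathbb{R}$ be a measurable and continuous functional. Assume $f(\widehat X^{\pi_n})\in L^p(\Omega)$ for all $n\in\mathbb{N}$ and that $(|f(\widehat X^{\pi_n})|^p)_{n\in\mathbb{N}}$ is uniformly integrable. Then for every $\varepsilon>0$ there exists $n_0\in\mathbb{N}$ such that for all $n\ge n_0$ there exists a linear functional $\boldsymbol\ell$ of the form $\boldsymbol\ell(\widehat{\mathbb X}^{\pi_n}_T)=\sum_{|I|\le N}\ell_I\langle e_I,\widehat{\mathbb X}^{\pi_n}_T\rangle$, for some $N\in\mathbb{N}_0$ and $\ell_I\in\mathbb{R}$, such that $$\mathbb E\bigl[|f(\widehat X)-\boldsymbol\ell(\widehat{\mathbb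 X}^{\pi_n}_T)|^p\bigr]<\varepsilon^p.$$ (ii) Let $f\colon[0,T]\times C([0,T];\mathbb{R}^{d+1})\to\mathbb{R}$ be a measurable, continuous, non-anticipative functional. Assume $f(t,\widehat X^{\pi_n})\in L^p([0,T]\times\Omega)$ for all $n\in\mathbb{N}$ and that $(|f(t,\widehat X^{\pi_n})|^p)_{n\in\mathbb{N}}$ is uniformly integrable (with respect to $dt\otimes\mathbb P$ on $[0,T]\times\Omega$). Then for every $\varepsilon>0$ there exists $n_0\in\mathbb{N}$ such that for all $n\ge n_0$ there exists a linear functional $\boldsymbol\ell$ of the form $\boldsymbol\ell(\widehat{\mathbb X}^{\pi_n}_t)=\sum_{|I|\le N}\ell_I\langle e_I,\widehat{\mathbb X}^{\pi_n}_t\rangle$, for some $N\in\mathbb{N}_0$ and $\ell_I\in\mathbb{R}$, such that $$\mathbb E\Bigl[\int_0^T\bigl|f(t,\widehat X)-\boldsymbol\ell(\widehat{\mathbb X}^{\pi_n}_t)\bigr|^p\,dt\Bigr]<\varepsilon^p.$$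
   Context: Covariance. $R_{X^i}(s,t)=\mathbb E[X^i_sX^i_t]$. For intervals $J,J'\subset[0,T]$ the two-dimensional $\varrho$-variation is $\|R_{X^i}\|_{\varrho;J\times J'}:=\bigl(\sup\sum_{[u,v]\in\mathcal P,\,[u',v']\in\mathcal P'}|\mathbb E[(X^i_v-X^i_u)(X^i_{v'}-X^i_{u'})]|^\varrho\bigr)^{1/\varrho}$, the supremum being over all partitions $\mathcal P$ of $J$ and $\mathcal P'$ of $J'$. $C([0,T];\mathbb{R}^{d+1})$ carries the topology of uniform convergence. A functional $f$ on $[0,T]\times C([0,T];\mathbb{R}^{d+1})$ is non-anticipative if $f(t,x)$ depends on $x$ only through the restriction $x|_{[0,t]}$, i.e. $f(t,x)=f(t,y)$ whenever $x=y$ on $[0,t]$. Piecewise linear interpolation along $\pi=\{0=t_0<\cdots<t_m=T\}$: $X^\pi_t=X_{t_k}+\frac{t-t_k}{t_{k+1}-t_k}(X_{t_{k+1}}-X_{t_k})$ for $t\in[t_k,t_{k+1}]$. Signature. The coordinates of $\mathbb{R}^{d+1}$ are indexed by $0,\ldots,d$, index $0$ being time, with canonical basis $e_0,\dots,e_d$. Multi-indices $I=(i_1,\ldots,i_k)$ have entries in $\{0,\ldots,d\}$, $|I|=k$, $e_I=e_{i_1}\otimes\cdots\otimes e_{i_k}$. $\widehat{\mathbb X}^{\pi_n}_t\in T((\mathbb{R}^{d+1}))=\prod_{k\ge0}(\mathbb{R}^{d+1})^{\otimes k}$ is the signature of $\widehat X^{\pi_n}$ on $[0,t]$: $\langle e_I,\widehat{\mathbb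 X}^{\pi_n}_t\rangle=\int_{0<u_1<\cdots<u_k<t}d\widehat X^{\pi_n,i_1}_{u_1}\cdots d\widehat X^{\pi_n,i_k}_{u_k}$ (pathwise Riemann–Stieltjes integrals), $\langle e_\emptyset,\cdot\rangle=1$. *)

(* Defs.v *)
From HB Require Import structures.
From mathcomp Require Import all_boot all_order all_algebra.
From mathcomp Require Import all_classical all_reals all_analysis.

Set Implicit Arguments.
Unset Strict Implicit.
Unset Printing Implicit Defensive.

Import Order.TTheory GRing.Theory Num.Theory.
Import numFieldNormedType.Exports.

Local Open Scope classical_set_scope.
Local Open Scope ring_scope.

Definition path_space (R : realType) (T : R) (n : nat) : Type :=
  continuousType (set_type [set` `[0, T]]) 'rV[R]_n.

(* [arrow_uniform_type] is the space of functions with the sup-distance, so the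
   initial topology of this inclusion is that of uniform convergence. *)
Definition path_fun (R : realType) (T : R) (n : nat) (x : path_space T n) :
    arrow_uniform_type (set_type [set` `[0, T]]) 'rV[R]_n :=
  (x : continuousType _ _).

HB.instance Definition _ (R : realType) (T : R) (n : nat) :=
  Choice.copy (path_space T n)
    (continuousType (set_type [set` `[0, T]]) 'rV[R]_n).
HB.instance Definition _ (R : realType) (T : R) (n : nat) :=
  isPointed.Build (path_space T n) (cst 0).
HB.instance Definition _ (R : realType) (T : R) (n : nat) :=
  PseudoMetric.copy (path_space T n) (initial_topology (@path_fun R T n)).

(* A path as a function of real time; the value 0 outside of [0,T] is junk. *)
Definition ev (R : realType) (T : R) (n : nat) (x : path_space T n) :
  R -> 'rV[R]_n := 'valL_ 0 (path_fun x).

Definition mk_path (R : realType) (T : R) (n : nat) (x : R -> 'rV[R]_n)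
    (cx : {within [set` `[0, T]], continuous x}) : path_space T n :=
  mkcts ((subspace_sigL_continuousP _ _).1 cx).

Section path_lemmas.
Variables (R : realType) (T : R).

Lemma ev_mk_path n (x : R -> 'rV[R]_n)
    (cx : {within [set` `[0, T]], continuous x}) t :
  0 <= t <= T -> ev (mk_path cx) t = x t.
Proof.
move=> t0T; have tT : t \in [set` `[0, T]] by rewrite inE/= in_itv.
transitivity ((('valL_ 0 \o sigL [set` `[0, T]]) x) t); first by [].
by rewrite sigLK /patch tT.
Qed.

Lemma ev_continuous n (x : path_space T n) :
  {within [set` `[0, T]], continuous (ev x)}.
Proof.
by apply/subspace_valL_continuousP'; exact: (@cts_fun _ _ (x : continuousType _ _)).
Qed.

Lemma continuous_rV (U : topologicalType) n (x : U -> 'rV[R]_n) :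
  (forall j, continuous (fun t => x t ord0 j)) -> continuous x.
Proof.
move=> cx t A [P nP PA]; rewrite /= nbhs_filterE.
have : \forall u \near t, forall j, P ord0 j (x u ord0 j).
  apply: filter_forall => j; apply: (cx j t); exact: nP.
by apply: filterS => u Pu; apply: PA => i j; rewrite (ord1 i).
Qed.

End path_lemmas.

(* x |-> ((t, x_t))_t, the time being the coordinate 0. *)
Definition time_ext_fun (R : realType) (n : nat) (x : R -> 'rV[R]_n) (t : R) :
  'rV[R]_n.+1 := \row_j (if unlift ord0 j is Some i then x t ord0 i else t).

Lemma time_ext_continuous (R : realType) (T : R) n (x : R -> 'rV[R]_n) :
  {within [set` `[0, T]], continuous x} ->
  {within [set` `[0, T]], continuous (time_ext_fun x)}.
Proof.
move=> cx; apply: continuous_rV => j.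
rewrite (_ : (fun t => _) =
  fun t => if unlift ord0 j is Some i then x t ord0 i else t); last first.
  by apply/funext => t; rewrite mxE.
case: (unlift ord0 j) => [i|]; last first.
  by apply: continuous_subspaceT => t; exact: cvg_id.
move=> t; apply: (@continuous_comp (subspace [set` `[0, T]]) 'rV[R]_n R x
  (fun M : 'rV[R]_n => M ord0 i)).
  exact: cx.
exact: coord_continuous.
Qed.

Definition time_ext (R : realType) (T : R) (n : nat) (x : path_space T n) :
  path_space T n.+1 := mk_path (time_ext_continuous (@ev_continuous R T n x)).

(* As in [itv_partition], the first point t_0 is left out of the list. *)
Structure partition_of (R : realType) (T : R) := PartitionOf {
  points :> seq R;
  points_itv_partition : itv_partition 0 T points }.

Definition steps (R : realType) (a : R) (s : seq R) : seq (R * R) :=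
  zip (a :: s) s.

Definition mesh (R : realType) (a : R) (s : seq R) : R :=
  \big[Num.max/0]_(uv <- steps a s) (uv.2 - uv.1).

Fixpoint interp_fun (R : realType) (n : nat) (x : R -> 'rV[R]_n)
    (a : R) (s : seq R) (t : R) : 'rV[R]_n :=
  if s is b :: s' then
    if t <= b then x a + ((t - a) / (b - a)) *: (x b - x a)
    else interp_fun x b s' t
  else x a.

Section interpolation.
Variables (R : realType) (n : nat) (x : R -> 'rV[R]_n).

Lemma interp_fun_left a s : path <%R a s -> interp_fun x a s a = x a.
Proof.
by case: s => //= b s /andP[/ltW -> _]; rewrite subrr mul0r scale0r addr0.
Qed.

Lemma interp_fun_continuous a s : path <%R a s -> continuous (interp_fun x a s).
Proof.
elim: s a => [a _|b s IH a /= /andP[ab bs]]; first exact: cst_continuous.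
pose F t := x a + ((t - a) / (b - a)) *: (x b - x a).
have Fb : F b = x b.
  by rewrite /F divff ?scale1r ?subr_eq0 ?gt_eqF// addrC subrK.
have Gb := interp_fun_left bs.
have -> : (fun t => if t <= b then F t else interp_fun x b s t) =
    (fun t => F (Num.min t b) + interp_fun x b s (Num.max t b) - x b).
  apply/funext => t; case: leP => tb; first by rewrite Gb addrK.
  by rewrite Fb addrC addKr.
have cF : continuous F.
  move=> t; apply: cvgD; first exact: cvg_cst.
  apply: cvgZr_tmp; apply: cvgMr_tmp; apply: cvgB; [exact: cvg_id|exact: cvg_cst].
move=> t; apply: cvgB; last exact: cvg_cst.
apply: cvgD.
  apply: (@continuous_comp _ _ _ (fun t => Num.min t b) F); last exact: cF.
  by apply: continuous_min; [exact: cvg_id|exact: cvg_cst].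
apply: (@continuous_comp _ _ _ (fun t => Num.max t b) (interp_fun x b s)).
  by apply: continuous_max; [exact: cvg_id|exact: cvg_cst].
exact: IH.
Qed.

End interpolation.

Definition interp (R : realType) (T : R) (n : nat) (pi : partition_of T)
    (x : path_space T n) : path_space T n :=
  mk_path (continuous_subspaceT (@interp_fun_continuous R n (ev x) 0 pi
    (proj1 (points_itv_partition pi)))).

Definition is_RS_integral (R : realType) (f g : R -> R) (a b l : R) : Prop :=
  forall e : R, 0 < e -> exists2 delta : R, 0 < delta &
    forall s xi : seq R, itv_partition a b s -> mesh a s < delta ->
      size xi = size s ->
      all (fun p => p.1.1 <= p.2 <= p.1.2) (zip (steps a s) xi) ->
      `|\sum_(p <- zip (steps a s) xi) f p.2 * (g p.1.2 - g p.1.1) - l| < e.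

Definition RS_integral (R : realType) (f g : R -> R) (a b : R) : R :=
  get (is_RS_integral f g a b).

(* The word is read backwards: the head of [w] is the index of the last, i.e.
   largest, integration variable. *)
Fixpoint iterated_integral (R : realType) (n : nat) (x : R -> 'rV[R]_n)
    (w : seq 'I_n) (t : R) : R :=
  if w is i :: w' then
    RS_integral (iterated_integral x w') (fun u => x u ord0 i) 0 t
  else 1.

(* An element S of T((R^n)) is given by its coordinates w |-> <e_w, S>. *)
Definition tensor_series (R : realType) (n : nat) : Type := seq 'I_n -> R.

Definition signature (R : realType) (T : R) (n : nat) (x : path_space T n)
    (t : R) : tensor_series R n :=
  fun w => iterated_integral (ev x) (rev w) t.

Definition linear_functional (R : realType) (n : nat) (N : nat)
    (l : seq 'I_n -> R) (S : tensor_series R n) : R :=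
  \sum_(k < N.+1) \sum_(w : k.-tuple 'I_n) l w * S w.

Section processes.
Variables (R : realType) (d : measure_display) (Omega : measurableType d).
Variable P : probability Omega R.

(* [normal_prob m 0] is not a Dirac mass in the library, hence the case split. *)
Definition gaussian_rv (Y : Omega -> R) : Prop :=
  measurable_fun setT Y /\
  exists m s : R, forall A : set R, measurable A ->
    P (Y @^-1` A) = if s == 0 then \d_m A else normal_prob m s A.

Definition component (T : R) (n : nat) (X : Omega -> path_space T n) (i : 'I_n)
  (t : R) : Omega -> R := fun w => ev (X w) t ord0 i.

Definition gaussian_process (T : R) (n : nat) (X : Omega -> path_space T n) :
    Prop :=
  forall (m : nat) (a : 'I_m -> R) (i : 'I_m -> 'I_n) (t : 'I_m -> R),
    (forall k, 0 <= t k <= T) ->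
    gaussian_rv (fun w => \sum_(k < m) a k * component X (i k) (t k) w).

Definition centred (T : R) (n : nat) (X : Omega -> path_space T n) : Prop :=
  forall (i : 'I_n) (t : R), 0 <= t <= T -> ('E_P[component X i t] = 0)%E.

Definition component_sigma (T : R) (n : nat) (X : Omega -> path_space T n)
    (i : 'I_n) : set (set Omega) :=
  <<s \bigcup_(t in [set` `[0, T]])
        preimage_set_system setT (component X i t) measurable >>.

Definition independent_components (T : R) (n : nat)
    (X : Omega -> path_space T n) : Prop :=
  forall (J : {set 'I_n}) (A : 'I_n -> set Omega),
    (forall i, i \in J -> component_sigma X i (A i)) ->
    P (\bigcap_(i in [set` J]) A i) = (\prod_(i in J) P (A i))%E.

(* The expectation is the increment over [u,v] x [u',v'] of the covariance
   function (s,t) |-> E[Y_s Y_t], whose rho-variation over [a,b] x [a',b'] is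
   taken. *)
Definition covariance_variation (Y : R -> Omega -> R) (rho a b a' b' : R) :
    \bar R :=
  ((ereal_sup [set (\sum_(uv <- steps a s) \sum_(uv' <- steps a' s')
      `|'E_P[(fun w => (Y uv.2 w - Y uv.1 w) * (Y uv'.2 w - Y uv'.1 w))%R]|
        `^ rho)%E
    | s in itv_partition a b & s' in itv_partition a' b']) `^ rho^-1)%E.

End processes.

Definition uniformly_integrable (R : realType) (d : measure_display)
    (S : measurableType d) (mu : {measure set S -> \bar R})
    (Y : nat -> S -> R) : Prop :=
  ereal_sup [set (\int[mu]_(z in [set z | (K <= `|Y n z|)%R]) `|Y n z|%R%:E)%E
            | n in [set: nat]] @[K --> +oo%R] --> 0%E.

Definition non_anticipative (R : realType) (T : R) (n : nat)
    (f : R -> path_space T n -> R) : Prop :=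
  forall (t : R) (x y : path_space T n), 0 <= t <= T ->
    (forall s, 0 <= s <= t -> ev x s = ev y s) -> f t x = f t y.

(* Main.v *)
Require Import Defs.
From mathcomp Require Import all_boot all_order all_algebra.
From mathcomp Require Import all_classical all_reals all_analysis.
From mathcomp Require Import measurable_realfun.
From mathcomp Require Import ring lra.

(** The proof composes two approximations.

The interpolated paths converge uniformly to the process, so the functional
along them converges pointwise by continuity, and uniform integrability
upgrades this to convergence in L^p ([vitali], used on the sample space for
the terminal statement and on [0, T] times the sample space for the running
one).  What remains, for one fixed partition, is to approximate a functional
of the interpolated path by linear functionals of the signature of that same
path ([signature_density]).

Along a fixed partition the path is determined by finitely many Gaussian
increments g, and the functional becomes a continuous function F(t, g) of
finitely many variables.  As functions of (t, g), linear functionals of the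
signature form an algebra, by the shuffle identity
[iterated_integral_shuffle].  Since s^l / l! is an iterated integral of the
time coordinate, this algebra contains t and every integral
int_0^t Q'(s) dx^i_s with Q a polynomial.  The affine combinations l of these,
the [generators], have two decisive properties.

First, they grow at most linearly in g, so that exp |p l| is integrable.  This
dominates the Taylor sums of cos l, which therefore converge to cos l in L^p:
the algebra, made of unbounded functions, approximates bounded trigonometric
functions.  The span of the cosines is itself stable under products, and
a Stone-Weierstrass argument produces from it functions that are uniformly
close to the truncated F on a large compact set and remain bounded outside of
it, where the measure is small ([stone_weierstrass_clamp], [lp_density]).

Secondly, they separate enough points: they determine t and the path on
[0, t].  Indeed, if two families of increments differ on an interval that
begins before t, consider the last such interval and let Q vanish at all nodes
up to its left end; then int_0^t Q' dx only sees that interval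
([generators_separate]).  A non-anticipative F depends on nothing else.

The Riemann-Stieltjes integrals that define the signature are handled through
the relation dy = sum_j f_j dx_j, written as a quadratic local estimate
([is_primitive]).  The estimate determines y from its initial value, obeys the
product rule, and implies that y is the Riemann-Stieltjes integral; explicit
formulas for integrals thus reduce to checking it. *)

Set Implicit Arguments.
Unset Strict Implicit.
Unset Printing Implicit Defensive.

Import Order.TTheory GRing.Theory Num.Theory.
Import numFieldNormedType.Exports.

Local Open Scope classical_set_scope.
Local Open Scope ring_scope.

(** * The relation dy = sum_j f_j dx_j *)

Definition lipschitz_upto (R : realType) (T : R) (y : R -> R) :=
  exists2 C, 0 <= C & forall u v, 0 <= u -> u <= v -> v <= T ->
    `|y v - y u| <= C * (v - u).

(** The relation dy = sum_j f_j dx_j on [0, T].  The tag [xi] is arbitrary in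
[u, v], so that the estimate compares increments of [y] with any tagged
Riemann-Stieltjes sum; the error is quadratic because [f] and [x] are
Lipschitz in all applications. *)
Definition is_primitive (R : realType) (T : R) n (x : R -> 'rV[R]_n)
    (f : 'I_n -> R -> R) (y : R -> R) :=
  exists2 C, 0 <= C & forall u xi v, 0 <= u -> u <= xi -> xi <= v -> v <= T ->
    `|y v - y u - \sum_j f j xi * (x v ord0 j - x u ord0 j)| <= C * (v - u) ^+ 2.

(** This says that [F] is an antiderivative of [f], in the form in which
derivatives enter the local estimates. *)
Definition mean_value (R : realType) (T : R) (F f : R -> R) :=
  forall a b, 0 <= a -> a <= b -> b <= T ->
    exists2 c, a <= c <= b & F b - F a = f c * (b - a).

Section primitives.
Variables (R : realType) (T : R).
Hypothesis T0 : 0 < T.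
Implicit Types (y z : R -> R).

Lemma lipschitz_upto_bounded y : lipschitz_upto T y ->
  exists2 B, 0 <= B & forall t, 0 <= t <= T -> `|y t| <= B.
Proof.
move=> [C C0 yC]; exists (`|y 0| + C * T).
  by rewrite addr_ge0// mulr_ge0// ltW.
move=> t /andP[t0 tT]; have := yC _ _ (lexx 0) t0 tT; rewrite subr0 => h.
rewrite -[y t](subrK (y 0)) addrC (le_trans (ler_normD _ _))// lerD2l.
by rewrite (le_trans h)// ler_wpM2l.
Qed.

Lemma lipschitz_upto_cst (c : R) : lipschitz_upto T (cst c).
Proof. by exists 0 => // u v *; rewrite subrr normr0 mul0r. Qed.

Section path.
Variables (n : nat) (x : R -> 'rV[R]_n).
Hypothesis xL : forall j, lipschitz_upto T (fun t => x t ord0 j).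
Implicit Types (f g : 'I_n -> R -> R).

Lemma path_increment_le : exists2 C, 0 <= C & forall j u v,
  0 <= u -> u <= v -> v <= T -> `|x v ord0 j - x u ord0 j| <= C * (v - u).
Proof.
have [C HC] : {C : 'I_n -> R & forall j, 0 <= C j /\ forall u v,
    0 <= u -> u <= v -> v <= T -> `|x v ord0 j - x u ord0 j| <= C j * (v - u)}.
  apply: (@choice _ _ (fun j c => 0 <= c /\ forall u v,
    0 <= u -> u <= v -> v <= T -> `|x v ord0 j - x u ord0 j| <= c * (v - u))).
  by move=> j; have [c c0 hc] := xL j; exists c.
exists (\sum_j C j); first by apply: sumr_ge0 => j _; case: (HC j).
move=> j u v u0 uv vT; apply: le_trans ((HC j).2 _ _ u0 uv vT) _.
rewrite ler_wpM2r ?subr_ge0// (bigD1 j)//= lerDl sumr_ge0// => i _.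
by case: (HC i).
Qed.

Lemma is_primitive_cst (c : R) : is_primitive T x (fun=> cst 0) (cst c).
Proof.
exists 0 => // u xi v *; rewrite subrr big1 ?subrr ?normr0 ?mul0r//.
by move=> j _; rewrite mul0r.
Qed.

Lemma is_primitiveD f g y z : is_primitive T x f y -> is_primitive T x g z ->
  is_primitive T x (fun j t => f j t + g j t) (fun t => y t + z t).
Proof.
move=> [C C0 fy] [D D0 gz]; exists (C + D); first exact: addr_ge0.
move=> u xi v u0 ux xv vT; under eq_bigr do rewrite mulrDl.
rewrite big_split/= mulrDl; set a := \sum__ _; set b := \sum__ _.
rewrite (_ : _ - _ = (y v - y u - a) + (z v - z u - b)); last by ring.
by rewrite (le_trans (ler_normD _ _))// lerD// ?fy// gz.
Qed.

Lemma is_primitiveZ f y (c : R) : is_primitive T x f y ->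
  is_primitive T x (fun j t => c * f j t) (fun t => c * y t).
Proof.
move=> [C C0 fy]; exists (`|c| * C); first exact: mulr_ge0.
move=> u xi v u0 ux xv vT; under eq_bigr do rewrite -mulrA.
by rewrite -mulr_sumr -!mulrBr normrM -mulrA ler_wpM2l// fy.
Qed.

Lemma eq_is_primitive f g y z :
  (forall j t, 0 <= t <= T -> f j t = g j t) ->
  (forall t, 0 <= t <= T -> y t = z t) ->
  is_primitive T x f y -> is_primitive T x g z.
Proof.
move=> fg yz [C C0 fy]; exists C => // u xi v u0 ux xv vT.
have h : forall t, u <= t -> t <= v -> 0 <= t <= T.
  by move=> t ut tv; rewrite (le_trans u0 ut) (le_trans tv vT).
have uv := le_trans ux xv.
rewrite -!yz ?h//; under eq_bigr do rewrite -fg ?h//.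
exact: fy.
Qed.

Lemma is_primitive_lipschitz f y : (forall j, lipschitz_upto T (f j)) ->
  is_primitive T x f y -> lipschitz_upto T y.
Proof.
move=> fL [C C0 fy]; have [D D0 xD] := path_increment_le.
have [B HB] : {B : 'I_n -> R & forall j, 0 <= B j /\
    forall t, 0 <= t <= T -> `|f j t| <= B j}.
  apply: (@choice _ _ (fun j b => 0 <= b /\
    forall t, 0 <= t <= T -> `|f j t| <= b)) => j.
  by have [b b0 hb] := lipschitz_upto_bounded (fL j); exists b.
exists (C * T + \sum_j B j * D).
  rewrite addr_ge0 ?mulr_ge0// ?(ltW T0)// sumr_ge0// => j _.
  by rewrite mulr_ge0//; case: (HB j).
move=> u v u0 uv vT; have := fy u u v u0 (lexx u) uv vT.
set s := \sum__ _ => h.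
have sle : `|s| <= (\sum_j B j * D) * (v - u).
  rewrite mulr_suml (le_trans (ler_norm_sum _ _ _))// ler_sum// => j _.
  rewrite normrM -mulrA ler_pM// ?xD//; apply: (HB j).2.
  by rewrite u0 (le_trans uv).
rewrite -[y v - y u](subrK s) (le_trans (ler_normD _ _))// mulrDl lerD//.
rewrite (le_trans h)// expr2 mulrA ler_wpM2r ?subr_ge0// ler_wpM2l//.
by lra.
Qed.

(** The product rule d(yz) = z dy + y dz: the increment of a product differs
from y(xi) dz + z(xi) dy by products of two increments, which are quadratic
for Lipschitz functions. *)
Lemma is_primitiveM f g y z : lipschitz_upto T y -> lipschitz_upto T z ->
  is_primitive T x f y -> is_primitive T x g z ->
  is_primitive T x (fun j t => f j t * z t + y t * g j t) (fun t => y t * z t).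
Proof.
move=> yL zL [C C0 fy] [D D0 gz].
have [B B0 yB] := lipschitz_upto_bounded yL.
have [B' B'0 zB] := lipschitz_upto_bounded zL.
have [L L0 yL'] := yL; have [L' L'0 zL'] := zL.
exists (B * D + B' * C + L * L' + L' * L).
  by rewrite !addr_ge0// mulr_ge0.
move=> u xi v u0 ux xv vT; have uv := le_trans ux xv.
have xi0 := le_trans u0 ux; have xiT := le_trans xv vT.
have {}fy := fy _ _ _ u0 ux xv vT; have {}gz := gz _ _ _ u0 ux xv vT.
under eq_bigr do rewrite mulrDl [f _ _ * _]mulrC -!mulrA.
rewrite big_split/= -!mulr_sumr.
set a := \sum__ _ in fy *; set b := \sum__ _ in gz *.
rewrite (_ : _ - _ = y xi * (z v - z u - b) + z xi * (y v - y u - a) +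
  (y v - y xi) * (z v - z u) - (z xi - z u) * (y v - y u)); last by ring.
have d0 : 0 <= v - u by rewrite subr_ge0.
have xB : `|y xi| <= B by apply: yB; rewrite xi0.
have xB' : `|z xi| <= B' by apply: zB; rewrite xi0.
rewrite (le_trans (ler_normB _ _))// ![in leRHS]mulrDl lerD//; last first.
 rewrite normrM expr2 mulrACA ler_pM//; last exact: yL'.
  rewrite (le_trans (zL' _ _ _ _ _))// ler_wpM2l//; lra.
rewrite (le_trans (ler_normD _ _))// lerD//; last first.
  rewrite normrM expr2 mulrACA ler_pM//; last exact: zL'.
  rewrite (le_trans (yL' _ _ _ _ _))// ler_wpM2l//; lra.
by rewrite (le_trans (ler_normD _ _))// lerD// normrM -mulrA ler_pM.
Qed.

(** The difference of the two solutions has increments of order h^2 over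
intervals of length h; over N equal steps they add up to C t^2 / N. *)
Lemma is_primitive_unique f y z : is_primitive T x f y ->
  is_primitive T x f z -> y 0 = z 0 -> forall t, 0 <= t <= T -> y t = z t.
Proof.
move=> fy /(is_primitiveZ (-1)) /(is_primitiveD fy)[C C0 h] yz0 t /andP[t0 tT].
pose w s := y s + -1 * z s.
have w0 : w 0 = 0 by rewrite /w yz0; ring.
suff wt : w t = 0 by rewrite /w in wt; lra.
have wC u v : 0 <= u -> u <= v -> v <= T -> `|w v - w u| <= C * (v - u) ^+ 2.
  move=> u0 uv vT; have := h u u v u0 (lexx u) uv vT.
  by rewrite big1 ?subr0// => j _; rewrite mulN1r subrr mul0r.
have step N k : (k <= N.+1)%N ->
    `|w (k%:R * (t / N.+1%:R))| <= k%:R * (C * (t / N.+1%:R) ^+ 2).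
  elim: k => [_|k IH kN]; first by rewrite !mul0r w0 normr0.
  have d0 : 0 <= t / N.+1%:R by rewrite divr_ge0.
  rewrite -[w _](subrK (w (k%:R * (t / N.+1%:R)))) (le_trans (ler_normD _ _))//.
  rewrite addrC [in leRHS]mulrSr mulrDl mul1r lerD// ?IH 1?ltnW//.
  apply: le_trans (wC _ _ _ _ _) _; first by rewrite mulr_ge0.
  - by rewrite ler_wpM2r// ler_nat.
  - rewrite mulrA ler_pdivrMr// (@le_trans _ _ (N.+1%:R * t))//.
      by rewrite ler_wpM2r// ler_nat.
    by rewrite mulrC ler_wpM2r.
  - by rewrite -mulrBl mulrSr addrAC subrr add0r mul1r.
apply/eqP; rewrite -normr_le0; apply/ler_addgt0Pl => e e0; rewrite addr0.
pose N := Num.truncn (C * t ^+ 2 / e).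
have := step N N.+1 (leqnn _); rewrite mulrCA divff// mulr1 => /le_trans; apply.
rewrite expr_div_n expr2 [_ *  (_ * _)]mulrCA !mulrA.
have -> : C * N.+1%:R * t * t / (N.+1%:R ^+ 2) = C * t ^+ 2 / N.+1%:R.
  by field; rewrite ?natr1 ?nat1r pnatr_eq0.
rewrite ler_pdivrMr// [e * _]mulrC -ler_pdivrMr//; apply: ltW.
exact: truncnS_gt.
Qed.

End path.
End primitives.

(** * Riemann-Stieltjes integrals *)

Section riemann_stieltjes.
Variables (R : realType).
Implicit Types (f g y : R -> R) (s : seq R).

Lemma fine_partition (h : R) (N : nat) (a : R) : 0 < h ->
  exists s, itv_partition a (a + N%:R * h) s /\ mesh a s <= h.
Proof.
move=> h0; elim: N a => [|N IH] a.
  by exists [::]; rewrite mul0r addr0 /mesh big_nil ltW//; do 2 split.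
have [s [[ps ls] ms]] := IH (a + h); exists (a + h :: s); split; last first.
  rewrite /mesh big_cons ge_max; apply/andP; split => //=.
  by rewrite addrC addKr.
split; first by rewrite /= ltrDl h0.
by apply/eqP; rewrite /= (eqP ls) -[N.+1%:R]natr1; ring.
Qed.

Lemma right_tags (a : R) s : path <%R a s ->
  all (fun p => p.1.1 <= p.2 <= p.1.2) (zip (steps a s) s).
Proof.
by elim: s a => //= b s IH a /andP[ab bs]; rewrite (ltW ab) lexx/= IH.
Qed.

(** Both limits are compared with the Riemann sum of one fine partition,
tagged by its right end points. *)
Lemma is_RS_integral_unique f g (t l l' : R) : 0 <= t ->
  is_RS_integral f g 0 t l -> is_RS_integral f g 0 t l' -> l = l'.
Proof.
move=> t0 fl fl'; apply/eqP; rewrite -subr_eq0 -normr_le0.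
apply/ler_addgt0Pl => e e0; rewrite addr0.
have e20 : 0 < e / 2 by rewrite divr_gt0.
have [d d0 hd] := fl _ e20; have [d' d'0 hd'] := fl' _ e20.
have [s [ps ms]] : exists s, itv_partition 0 t s /\ mesh 0 s < Num.min d d'.
  have [->|tn0] := eqVneq t 0.
    by exists [::]; split; rewrite ?lexx /mesh ?big_nil ?lt_min ?d0//; split.
  have tp : 0 < t by rewrite lt_neqAle eq_sym tn0.
  pose N := Num.truncn (t / Num.min d d').
  have h0 : 0 < t / N.+1%:R by rewrite divr_gt0.
  have [s [ps ms]] := fine_partition N.+1 0 h0; exists s; split.
    by move: ps; rewrite add0r mulrCA divff ?mulr1// pnatr_eq0.
  rewrite (le_lt_trans ms)// ltr_pdivrMr// mulrC -ltr_pdivrMr ?lt_min ?d0//.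
  exact: truncnS_gt.
have tags := right_tags (proj1 ps).
have h := hd s s ps; have h' := hd' s s ps.
rewrite lt_min in ms; case/andP: ms => ms ms'.
have {}h := h ms erefl tags; have {}h' := h' ms' erefl tags.
set S := \sum_(_ <- _) _ in h h'.
rewrite (_ : l - l' = (S - l') - (S - l)); last by ring.
by rewrite (le_trans (ler_normB _ _))// [e in leRHS]splitr lerD// ltW.
Qed.

(** Each term of a Riemann sum is within C (v - u)^2 of an increment of [y];
these errors add up to at most C t times the mesh. *)
Lemma is_RS_integral_primitive (T : R) n (x : R -> 'rV[R]_n) (i : 'I_n) f y t :
  is_primitive T x (fun j => if j == i then f else cst 0) y ->
  0 <= t <= T -> is_RS_integral f (fun u => x u ord0 i) 0 t (y t - y 0).
Proof.
move=> [C C0 fy] /andP[t0 tT] e e0.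
have {}fy u xi v : 0 <= u -> u <= xi -> xi <= v -> v <= T ->
    `|f xi * (x v ord0 i - x u ord0 i) - (y v - y u)| <= C * (v - u) ^+ 2.
  move=> u0 ux xv vT; rewrite distrC; have := fy u xi v u0 ux xv vT.
  rewrite (bigD1 i)//= eqxx big1 ?addr0// => j /negPf ->.
  by rewrite mul0r.
(* The summand 1 only serves to keep the denominator positive. *)
pose d := e / (C * T + 1).
have CT0 : 0 < C * T + 1 by rewrite ltr_pwDr// mulr_ge0// (le_trans t0).
have d0 : 0 < d by rewrite divr_gt0.
have key s xi a : 0 <= a -> path <%R a s -> last a s = t -> mesh a s < d ->
    size xi = size s ->
    all (fun p => p.1.1 <= p.2 <= p.1.2) (zip (steps a s) xi) ->
    `|\sum_(p <- zip (steps a s) xi) f p.2 * (x p.1.2 ord0 i - x p.1.1 ord0 i) -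
      (y t - y a)| <= C * d * (t - a); last first.
  exists d => // s xi [ps /eqP ls] ms sz tags.
  apply: le_lt_trans (key s xi 0 _ ps ls ms sz tags) _ => //; rewrite subr0 mulrAC.
  rewrite (@le_lt_trans _ _ (C * T * d)) ?ler_wpM2r ?ler_wpM2l ?(ltW d0)//.
  by rewrite /d mulrA ltr_pdivrMr// mulrC ltr_pM2l// ltrDl.
elim: s xi a => /= [|b s IH] xi a a0 ps ls.
  move=> _ /size0nil -> _; rewrite -ls !subrr subr0 mulr0.
  by rewrite big_nil normr0.
case: xi => //= c xi.
rewrite (_ : mesh a (b :: s) = Num.max (b - a) (mesh b s)); last first.
  by rewrite /mesh big_cons.
rewrite gt_max => /andP[ba ms] [sz].
move=> /andP[/andP[ac cb] tags]; rewrite big_cons/=.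
case/andP: ps => ab ps; have b0 : 0 <= b by rewrite (le_trans a0)// ltW.
have {}IH := IH xi b b0 ps ls ms sz tags.
have bt : b <= t by apply: (@itv_partition_le _ _ _ _ s); split => //; apply/eqP.
set S := \sum_(_ <- _) _ in IH *.
rewrite (_ : _ - _ = (f c * (x b ord0 i - x a ord0 i) - (y b - y a)) +
  (S - (y t - y b))); last by ring.
rewrite (le_trans (ler_normD _ _))// (_ : C * d * (t - a) =
  C * d * (b - a) + C * d * (t - b)); last by ring.
rewrite lerD// (le_trans (fy _ _ _ a0 ac cb (le_trans bt tT)))//.
by rewrite -mulrA ler_wpM2l// expr2 ler_wpM2r// ?subr_ge0 ltW.
Qed.

Lemma RS_integral_primitive (T : R) n (x : R -> 'rV[R]_n) (i : 'I_n) f y t :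
  is_primitive T x (fun j => if j == i then f else cst 0) y ->
  0 <= t <= T -> RS_integral f (fun u => x u ord0 i) 0 t = y t - y 0.
Proof.
move=> fy t0T; have h := is_RS_integral_primitive fy t0T.
apply: get_unique => // l hl; apply: is_RS_integral_unique h => //.
by case/andP: t0T.
Qed.

End riemann_stieltjes.

(** * Integration against piecewise affine functions *)

Section clamp.
Variables (R : realType).

Definition clamp (p q t : R) := Num.min q (Num.max p t).

(** A continuous piecewise affine function is a constant plus a combination
of [clamp]s, one per interval of affinity.  Integrals against such a function
are sums of ordinary integrals, each over one interval stopped at t. *)
Definition piecewise_affine (T : R) (h : R -> R) :=
  exists (c : R) (m : nat) (a p q : 'I_m -> R),
    (forall k, 0 <= p k /\ p k <= q k /\ q k <= T) /\
    forall t, 0 <= t <= T -> h t = c + \sum_k a k * clamp (p k) (q k) t.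

Lemma clamp_itv (p q t : R) : p <= q -> p <= clamp p q t <= q.
Proof.
by move=> pq; rewrite /clamp le_min pq le_max lexx/= ge_min lexx.
Qed.

(** Either [clamp] does not move between [u] and [v], or both of its values
lie between [u] and [v]; then so does any intermediate point that the mean
value property supplies for them. *)
Lemma clampP (p q u v : R) : p <= q -> u <= v ->
  clamp p q u = clamp p q v \/
  [/\ u <= clamp p q u, clamp p q u <= clamp p q v & clamp p q v <= v].
Proof.
rewrite /clamp /Num.min /Num.max => pq uv.
case: (ltP p u) => pu; case: (ltP p v) => pv; case: ltP => h; case: ltP => h';
  try (by left; lra); (try by right; split; lra); left; lra.
Qed.

Lemma mean_value_clamp (T : R) F f (p q : R) : 0 <= p -> p <= q -> q <= T ->
  mean_value T F f -> lipschitz_upto T f ->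
  exists2 C, 0 <= C & forall u xi v, 0 <= u -> u <= xi -> xi <= v -> v <= T ->
    `|F (clamp p q v) - F (clamp p q u) -
      f xi * (clamp p q v - clamp p q u)| <= C * (v - u) ^+ 2.
Proof.
move=> p0 pq qT Ff [C C0 fC]; exists C => // u xi v u0 ux xv vT.
have uv := le_trans ux xv.
have [->|[h1 h2 h3]] := clampP pq uv.
  by rewrite !subrr mulr0 subr0 normr0 mulr_ge0// sqr_ge0.
have [c /andP[c1 c2] ->] := Ff _ _ (le_trans u0 h1) h2 (le_trans h3 vT).
rewrite -mulrBl normrM expr2 mulrA; apply: ler_pM => //; last first.
  by rewrite ger0_norm; lra.
have [xc|/ltW xc] := leP xi c.
  rewrite (le_trans (fC _ _ _ xc _)) ?(le_trans u0 ux)//; first by lra.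
  by rewrite ler_wpM2l//; lra.
rewrite distrC (le_trans (fC _ _ _ xc _))//; [lra|lra|].
by rewrite ler_wpM2l//; lra.
Qed.

(** For x^i = c + sum_k a_k clamp(p_k, q_k), the integral of f = F' against
x^i is given by the explicit formula on the right. *)
Lemma is_primitive_clamp (T : R) n (x : R -> 'rV[R]_n) (i : 'I_n) F f
    (c : R) m (a p q : 'I_m -> R) :
  (forall k, 0 <= p k /\ p k <= q k /\ q k <= T) ->
  (forall t, 0 <= t <= T ->
    x t ord0 i = c + \sum_k a k * clamp (p k) (q k) t) ->
  mean_value T F f -> lipschitz_upto T f ->
  is_primitive T x (fun j => if j == i then f else cst 0)
    (fun t => \sum_k a k * (F (clamp (p k) (q k) t) - F (p k))).
Proof.
move=> pq xE Ff fL.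
have {}Ff k := mean_value_clamp (pq k).1 (pq k).2.1 (pq k).2.2 Ff fL.
have [C HC] : {C : 'I_m -> R & forall k, 0 <= C k /\
    forall u xi v, 0 <= u -> u <= xi -> xi <= v -> v <= T ->
    `|F (clamp (p k) (q k) v) - F (clamp (p k) (q k) u) -
      f xi * (clamp (p k) (q k) v - clamp (p k) (q k) u)| <= C k * (v - u) ^+ 2}.
  apply: (@choice _ _ (fun k C => 0 <= C /\
    forall u xi v, 0 <= u -> u <= xi -> xi <= v -> v <= T ->
    `|F (clamp (p k) (q k) v) - F (clamp (p k) (q k) u) -
      f xi * (clamp (p k) (q k) v - clamp (p k) (q k) u)| <= C * (v - u) ^+ 2)).
  by move=> k; have [C C0 h] := Ff k; exists C.
exists (\sum_k `|a k| * C k).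
  by rewrite sumr_ge0// => k _; rewrite mulr_ge0//; case: (HC k).
move=> u xi v u0 ux xv vT; have uv := le_trans ux xv.
rewrite (bigD1 i)//= eqxx [\sum_(j | j != i) _]big1 ?addr0; last first.
  by move=> j /negPf ->; rewrite mul0r.
rewrite !xE ?u0 ?vT ?(le_trans u0 uv) ?(le_trans uv)//.
rewrite (addrC c) addrKA -!sumrB mulr_sumr -!sumrB mulr_suml.
rewrite (le_trans (ler_norm_sum _ _ _))// ler_sum// => k _.
set A := clamp _ _ v; set B := clamp _ _ u.
rewrite (_ : _ - _ = a k * (F A - F B - f xi * (A - B))); last by ring.
by rewrite normrM -mulrA ler_wpM2l//; apply: (HC k).2.
Qed.

Lemma piecewise_affine_lipschitz (T : R) h :
  piecewise_affine T h -> lipschitz_upto T h.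
Proof.
move=> [c [m [a [p [q [pq hE]]]]]]; exists (\sum_k `|a k|).
  by rewrite sumr_ge0.
move=> u v u0 uv vT; rewrite !hE ?u0 ?vT ?(le_trans u0 uv) ?(le_trans uv)//.
rewrite (addrC c) addrKA -!sumrB mulr_suml.
rewrite (le_trans (ler_norm_sum _ _ _))// ler_sum// => k _.
rewrite -mulrBr normrM ler_wpM2l//.
have [->|[h1 h2 h3]] := clampP (pq k).2.1 uv.
  by rewrite subrr normr0 subr_ge0.
by rewrite ger0_norm; lra.
Qed.

(** [f] is first extended by constants outside [0, T] and then integrated from
-1 on: in this way 0 and T become interior points, at which the fundamental
theorem of calculus gives a two-sided derivative. *)
Lemma lipschitz_antiderivative (T : R) f : 0 < T -> lipschitz_upto T f ->
  exists F, mean_value T F f.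
Proof.
move=> T0 fL; pose g t := f (clamp 0 T t).
have cg : continuous g.
  have [C C0 fC] := fL => t.
  have gC u v : u <= v -> `|g v - g u| <= C * (v - u).
    move=> uv; rewrite /g; have [->|[h1 h2 h3]] := clampP (ltW T0) uv.
      by rewrite subrr normr0 mulr_ge0// subr_ge0.
    have /andP[? ?] := clamp_itv u (ltW T0).
    have /andP[? ?] := clamp_itv v (ltW T0).
    by rewrite (le_trans (fC _ _ _ _ _))// ler_wpM2l//; lra.
  apply/cvgrPdist_le => e e0; near=> u.
  have ut : `|t - u| <= e / (C + 1).
    near: u; apply: cvgr_dist_le; first exact: cvg_id.
    by rewrite divr_gt0// ltr_wpDl.
  apply: (@le_trans _ _ ((C + 1) * `|t - u|)); last first.
    by rewrite mulrC -ler_pdivlMr// ltr_wpDl.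
  have [tu|/ltW tu] := leP t u.
    rewrite distrC (le_trans (gC _ _ tu))// distrC (@ger0_norm _ (u - t)).
      by rewrite ler_wpM2r ?lerDl// subr_ge0.
    by rewrite subr_ge0.
  rewrite (le_trans (gC _ _ tu))// (@ger0_norm _ (t - u)) ?subr_ge0//.
  by rewrite ler_wpM2r ?lerDl// subr_ge0.
pose F (t : R) : R := (\int[lebesgue_measure]_(s in `[(-1)%R, t]) g s)%R.
have dF t : 0 <= t <= T -> is_derive (t : R) 1 F (g t).
  move=> /andP[t0 tT].
  have [|||d1 d2] := @continuous_FTC1_closed _ g (-1) t (T + 1) _ _ _ (cg t).
  - by lra.
  - apply: continuous_compact_integrable; first exact: segment_compact.
    by apply: continuous_subspaceT.
  - by lra.
  have d2' : 'D_1 F t = g t by rewrite -derive1E.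
  exact: DeriveDef d1 d2'.
exists F => a b a0 ab bT.
have [||c cab ->] := @MVT_segment _ F g _ _ ab.
- move=> t; rewrite in_itv/= => /andP[/ltW ta /ltW tb]; apply: dF.
  by rewrite (le_trans a0)// (le_trans tb).
- apply: derivable_within_continuous => t; rewrite in_itv/= => /andP[ta tb].
  have /dF[] : 0 <= t <= T by rewrite (le_trans a0)// (le_trans tb).
  by [].
exists c; first by rewrite in_itv/= in cab.
move: cab; rewrite in_itv/= => /andP[ac cb]; congr (f _ * _).
rewrite /clamp max_r ?min_r//; [exact: le_trans bT|exact: le_trans ac].
Unshelve. all: by end_near.
Qed.

Lemma horner_mean_value (T : R) (Q : {poly R}) :
  mean_value T (horner Q) (horner Q^`()).
Proof.
move=> a b _ ab _.
have dQ t : is_derive (t : R) 1 (horner Q) (Q^`()).[t].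
  apply: DeriveDef; first exact: derivable_horner.
  by rewrite -derive1E -derivE.
have [c cab ->] := MVT_segment ab (fun t _ => dQ t)
  (derivable_within_continuous (fun t _ => @derivable_horner _ Q t)).
by exists c => //; rewrite in_itv/= in cab.
Qed.

End clamp.

(** * Iterated integrals and the shuffle identity *)

Section iterated_integrals.
Variables (R : realType) (T : R) (n : nat) (x : R -> 'rV[R]_n).
Hypothesis T0 : 0 < T.
Hypothesis xA : forall j, piecewise_affine T (fun t => x t ord0 j).
Implicit Types (w v : seq 'I_n).

Let xL j : lipschitz_upto T (fun t => x t ord0 j).
Proof. exact: piecewise_affine_lipschitz. Qed.

(** One step of the induction on words: the integrand is Lipschitz, hence has an
antiderivative, from which the explicit formula for the integral is built. *)
Lemma iterated_integral_cons_primitive i w :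
  lipschitz_upto T (iterated_integral x w) ->
  is_primitive T x (fun j => if j == i then iterated_integral x w else cst 0)
    (iterated_integral x (i :: w)) /\ iterated_integral x (i :: w) 0 = 0.
Proof.
move=> wL; have [F Fw] := lipschitz_antiderivative T0 wL.
have [c [m [a [p [q [pq xE]]]]]] := xA i.
have := is_primitive_clamp pq xE Fw wL; set y := (y in is_primitive _ _ _ y).
move=> yP; have wE t (t0T : 0 <= t <= T) := RS_integral_primitive yP t0T.
split; last by rewrite /= wE ?lexx ?ltW// subrr.
have := is_primitiveD yP (is_primitive_cst T x (- y 0)).
apply: eq_is_primitive => // [j t _|t t0T]; last by rewrite /= wE.
by rewrite addr0.
Qed.

Lemma iterated_integral_lipschitz w : lipschitz_upto T (iterated_integral x w).
Proof.
elim: w => [|i w IH]; first exact: lipschitz_upto_cst.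
have [iP _] := iterated_integral_cons_primitive i IH.
apply: is_primitive_lipschitz iP => // j.
by case: (j == i) => //; exact: lipschitz_upto_cst.
Qed.

Lemma iterated_integral_consP i w :
  is_primitive T x (fun j => if j == i then iterated_integral x w else cst 0)
    (iterated_integral x (i :: w)).
Proof.
exact: (iterated_integral_cons_primitive i (iterated_integral_lipschitz w)).1.
Qed.

Lemma iterated_integral_cons0 i w : iterated_integral x (i :: w) 0 = 0.
Proof.
exact: (iterated_integral_cons_primitive i (iterated_integral_lipschitz w)).2.
Qed.

Lemma sum_cons_primitive i (s : seq (seq 'I_n)) :
  is_primitive T x
    (fun j t => if j == i then \sum_(w <- s) iterated_integral x w t else 0)
    (fun t => \sum_(w <- s) iterated_integral x (i :: w) t).
Proof.
elim: s => [|w s IH].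
  apply: eq_is_primitive (is_primitive_cst T x 0) => [j t _|t _].
    by rewrite big_nil if_same.
  by rewrite big_nil.
have := is_primitiveD (iterated_integral_consP i w) IH.
apply: eq_is_primitive => [j t _|t _]; last by rewrite big_cons.
by rewrite big_cons; case: (j == i) => //; rewrite addr0.
Qed.

End iterated_integrals.

(** The recursion decreases one of two words at a time, hence the nested
fixpoint. *)
Fixpoint shuffle (S : Type) (w : seq S) : seq S -> seq (seq S) :=
  if w is i :: w' then
    fix shuffle_w v := if v is j :: v' then
      map (cons i) (shuffle w' v) ++ map (cons j) (shuffle_w v') else [:: w]
  else fun v => [:: v].

Lemma shuffle_cons S (i j : S) w v : shuffle (i :: w) (j :: v) =
  map (cons i) (shuffle w (j :: v)) ++ map (cons j) (shuffle (i :: w) v).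
Proof. by []. Qed.

(** Both sides vanish at 0 and, by the product rule and induction on the
two words, satisfy the same differential relation. *)
Lemma iterated_integral_shuffle (R : realType) (T : R) (n : nat)
    (x : R -> 'rV[R]_n) (w v : seq 'I_n) (t : R) :
  0 < T -> (forall j, piecewise_affine T (fun t => x t ord0 j)) ->
  0 <= t <= T ->
  iterated_integral x w t * iterated_integral x v t =
  \sum_(u <- shuffle w v) iterated_integral x u t.
Proof.
move=> T0 xA; elim: w v t => [v t _|i w IHw]; first by rewrite big_seq1 mul1r.
elim=> [|j v IHv] t t0T; first by rewrite big_seq1 mulr1.
rewrite shuffle_cons big_cat !big_map.
have iL u := iterated_integral_lipschitz T0 xA u.
have cP k u := iterated_integral_consP T0 xA k u.
have c0 k u := iterated_integral_cons0 T0 xA k u.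
have h1 := is_primitiveM T0 (iL (i :: w)) (iL (j :: v)) (cP i w) (cP j v).
have h2 := is_primitiveD (sum_cons_primitive T0 xA i (shuffle w (j :: v)))
  (sum_cons_primitive T0 xA j (shuffle (i :: w) v)).
have {}h1 := eq_is_primitive _ (fun t _ => erefl) h1.
apply: (is_primitive_unique (h1 _ _) h2 _ t0T) => [k s s0T|].
  have [->|ki] := eqVneq k i; have [kj|kj] := eqVneq _ j;
  by rewrite ?mul0r ?mulr0 ?add0r ?addr0 -?IHv -?IHw.
by rewrite !c0 mul0r !big1 ?addr0// => u _; rewrite c0.
Qed.

(** * The algebra of linear functionals of the signature *)

(** The functions of a time in [0, T] and of a parameter [g] that are fixed
linear combinations of iterated integrals of the path [x g], with
coefficients independent of both.  A list of coefficients and words, possibly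
with repetitions, makes stability under the algebra operations immediate. *)
Definition signature_functional (R : realType) (T : R) (n : nat) (G : Type)
    (x : G -> R -> 'rV[R]_n) (a : R * G -> R) :=
  exists c : seq (R * seq 'I_n), forall t g, 0 <= t <= T ->
    a (t, g) = \sum_(aw <- c) aw.1 * iterated_integral (x g) aw.2 t.

Section signature_functional.
Variables (R : realType) (T : R) (n : nat) (G : Type) (x : G -> R -> 'rV[R]_n).
Implicit Types a b : R * G -> R.

Lemma signature_functional_word w :
  signature_functional T x (fun z => iterated_integral (x z.2) w z.1).
Proof. by exists [:: (1, w)] => t g _; rewrite big_seq1 mul1r. Qed.

Lemma eq_signature_functional a b :
  (forall t g, 0 <= t <= T -> a (t, g) = b (t, g)) ->
  signature_functional T x a -> signature_functional T x b.
Proof. by move=> ab [c ac]; exists c => t g t0T; rewrite -ab// ac. Qed.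

Lemma signature_functional_cst (r : R) : signature_functional T x (cst r).
Proof. by exists [:: (r, [::])] => t g _; rewrite big_seq1 mulr1. Qed.

Lemma signature_functionalD a b : signature_functional T x a ->
  signature_functional T x b -> signature_functional T x (fun z => a z + b z).
Proof.
move=> [c ac] [d bd]; exists (c ++ d) => t g t0T.
by rewrite ac// bd// big_cat.
Qed.

Lemma signature_functionalZ (r : R) a : signature_functional T x a ->
  signature_functional T x (fun z => r * a z).
Proof.
move=> [c ac]; exists [seq (r * aw.1, aw.2) | aw <- c] => t g t0T.
by rewrite ac// big_map mulr_sumr; apply: eq_bigr => aw _; rewrite mulrA.
Qed.

Lemma signature_functional_sum (I : Type) (s : seq I) (a : I -> R * G -> R) :
  (forall i, signature_functional T x (a i)) ->
  signature_functional T x (fun z => \sum_(i <- s) a i z).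
Proof.
move=> aP; elim: s => [|i s IH].
  apply: eq_signature_functional (signature_functional_cst 0) => t g _.
  by rewrite big_nil.
apply: eq_signature_functional (signature_functionalD (aP i) IH) => t g _.
by rewrite big_cons.
Qed.

Lemma signature_functionalM a b : 0 < T ->
  (forall g j, piecewise_affine T (fun t => x g t ord0 j)) ->
  signature_functional T x a -> signature_functional T x b ->
  signature_functional T x (fun z => a z * b z).
Proof.
move=> T0 xA [c ac] [d bd].
pose e (aw bv : R * seq 'I_n) (z : R * G) := (aw.1 * bv.1) *
  \sum_(u <- shuffle aw.2 bv.2) iterated_integral (x z.2) u z.1.
apply: (@eq_signature_functional (fun z => \sum_(aw <- c) \sum_(bv <- d) e aw bv z)).
  move=> t g t0T; rewrite ac// bd// mulr_suml; apply: eq_bigr => aw _.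
  rewrite mulr_sumr; apply: eq_bigr => bv _; rewrite /e/=.
  rewrite -(iterated_integral_shuffle _ _ T0)//; ring.
do 2 (apply: signature_functional_sum => ?).
apply: signature_functionalZ; apply: signature_functional_sum => u.
exact: signature_functional_word.
Qed.

(** Repeated words are merged by adding up their coefficients. *)
Lemma signature_functional_linear a : signature_functional T x a ->
  exists N l, forall t g, 0 <= t <= T ->
    a (t, g) = linear_functional N l
      (fun w => iterated_integral (x g) (rev w) t).
Proof.
move=> [c ac]; exists (\max_(aw <- c) size aw.2)%N.
exists (fun w => \sum_(aw <- c | aw.2 == rev w) aw.1) => t g t0T.
rewrite ac// /linear_functional.
pose h (w : seq 'I_n) (aw : R * seq 'I_n) := if aw.2 == rev w then
  aw.1 * iterated_integral (x g) (rev w) t else 0.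
rewrite [RHS](_ : _ = \sum_(k < (\max_(aw <- c) size aw.2).+1)
    \sum_(aw <- c) \sum_(w : k.-tuple 'I_n) h w aw); last first.
  apply: eq_bigr => k _; rewrite exchange_big/=; apply: eq_bigr => w _.
  by rewrite mulr_suml big_mkcond.
rewrite exchange_big/=; rewrite big_seq [RHS]big_seq; apply: eq_bigr => aw awc.
have szN : (size aw.2 < (\max_(aw <- c) size aw.2).+1)%N.
  by rewrite ltnS (big_rem aw)//= leq_maxl.
rewrite (bigD1 (Ordinal szN))//= [X in _ + X]big1 ?addr0; last first.
  move=> k kN; rewrite big1// => w _; rewrite /h; case: eqP => // e.
  case/eqP: kN; apply: val_inj => /=.
  by rewrite e size_rev size_tuple.
rewrite (bigD1 (rev_tuple (in_tuple aw.2)))//= {1}/h revK eqxx big1 ?addr0//.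
move=> w wN; rewrite /h; case: eqP => // e; case/eqP: wN; apply: val_inj => /=.
by rewrite -[LHS]revK; congr rev.
Qed.

End signature_functional.

(** * A Stone-Weierstrass theorem for spans of cosines *)

(** If [Q] failed on [K], the sets whose complement in [K] satisfies [Q] would
form a proper filter containing [K]; its cluster point contradicts the local
hypothesis. *)
Lemma compact_induction (E : topologicalType) (K : set E) (Q : set E -> Prop) :
  compact K -> Q set0 -> (forall A B, A `<=` B -> Q B -> Q A) ->
  (forall A B, Q A -> Q B -> Q (A `|` B)) ->
  (forall y, K y -> exists2 V, nbhs y V & Q (V `&` K)) -> Q K.
Proof.
move=> cK Q0 Qs QU Qloc; apply: contrapT => nQK.
pose F : set_system E := fun V => Q (K `\` V).
have FF : ProperFilter F.
  apply: Build_ProperFilter_ex.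
    move=> V FV; apply: contrapT => nV; apply: nQK; apply: Qs FV => z Kz.
    by split => // Vz; apply: nV; exists z.
  split; rewrite /F.
  - by rewrite setDT.
  - by move=> A B QA QB; rewrite setDIr; exact: QU.
  - by move=> A B AB; apply: Qs => z [Kz nBz]; split=> // /AB.
have [|y [Ky cy]] := cK F FF; first by rewrite /F setDv.
have [V yV QV] := Qloc y Ky.
have [|z [/= nVz Vz]] := cy (~` V) V _ yV; last by [].
by rewrite /F setDE setCK setIC.
Qed.

Section sqrt_iteration.
Variable R : realType.

(** An iteration for the square root of y^2: for |y| <= 1 these polynomials in
[y] increase to |y|. *)
Fixpoint abs_approx (y : R) (n : nat) : R :=
  if n is m.+1 then
    abs_approx y m + (y ^+ 2 - abs_approx y m ^+ 2) / 2
  else 0.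

(** The error is at most 2 / n, uniformly in [y]. *)
Lemma abs_approxP (y : R) n : `|y| <= 1 ->
  0 <= `|y| - abs_approx y n /\ (`|y| - abs_approx y n) * n%:R <= 2.
Proof.
move=> y1; set a := `|y|.
have a0 : 0 <= a by exact: normr_ge0.
have yE : y ^+ 2 = a ^+ 2 by rewrite /a real_normK// num_real.
(* The factor 1 - (a + q) / 2 by which an iteration shrinks the error is at
   most 1 - a / 2, and (1 - s) (1 + (n + 1) s) <= 1 + n s. *)
suff [h0 [h1 h2]] : 0 <= abs_approx y n /\ 0 <= a - abs_approx y n /\
    (a - abs_approx y n) * (1 + n%:R * (a / 2)) <= a.
  split => //; have [->|an0] := eqVneq a 0.
    rewrite sub0r mulNr; apply: (@le_trans _ _ 0) => //.
    by rewrite oppr_le0 mulr_ge0.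
  have ap : 0 < a by rewrite lt_neqAle eq_sym an0.
  have n0 : 0 <= n%:R :> R by [].
  rewrite -(ler_pM2r ap); set e := a - _ in h1 h2 *; nra.
elim: n => [|n [h0 [h1 h2]]] /=; first by rewrite !mul0r !addr0 subr0 mulr1.
rewrite yE; set q := abs_approx y n in h0 h1 h2 *.
rewrite -/a in y1.
have n0 : 0 <= n%:R :> R by [].
have -> : a - (q + (a ^+ 2 - q ^+ 2) / 2) = (a - q) * (1 - (a + q) / 2).
  by field.
have q0 : 0 <= 1 - (a + q) / 2 by lra.
split; first by rewrite addr_ge0// divr_ge0// subr_ge0 lerXn2r ?nnegrE//; lra.
split; first by rewrite mulr_ge0.
apply: le_trans h2; rewrite -mulrA ler_wpM2l// -[n.+1%:R]natr1.
apply: (@le_trans _ _ ((1 - a / 2) * (1 + (n%:R + 1) * (a / 2)))).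
  rewrite ler_wpM2r ?addr_ge0 ?mulr_ge0 ?addr_ge0 ?divr_ge0//; lra.
have : 0 <= (n%:R + 1) * (a / 2) ^+ 2.
  by rewrite mulr_ge0 ?sqr_ge0 ?addr_ge0.
move: (n%:R) n0 => N n0 H; nra.
Qed.

End sqrt_iteration.

Section cos_span.
Variables (R : realType) (E : Type) (L : set (E -> R)).
Implicit Types h k : E -> R.

Inductive cos_span : (E -> R) -> Prop :=
| cos_span_cos l : L l -> cos_span (fun z => cos (l z))
| cos_spanD h k : cos_span h -> cos_span k -> cos_span (fun z => h z + k z)
| cos_spanZ c h : cos_span h -> cos_span (fun z => c * h z).

Definition uniform_cos_span h := forall e : R, 0 < e ->
  exists2 k, cos_span k & forall z, `|h z - k z| <= e.

Lemma cos_span_bounded h : cos_span h ->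
  exists2 B, 0 < B & forall z, `|h z| <= B.
Proof.
elim=> [l _|h1 h2 _ [B B0 hB] _ [C C0 hC]|c h1 _ [B B0 hB]].
- by exists 1 => // z; rewrite ler_norml cos_geN1 cos_le1.
- exists (B + C) => [|z]; first exact: addr_gt0.
  by rewrite (le_trans (ler_normD _ _))// lerD.
- exists ((`|c| + 1) * B) => [|z]; first by rewrite mulr_gt0// ltr_pwDr.
  by rewrite normrM ler_pM// lerDl.
Qed.

Hypothesis Lcst : forall c : R, L (cst c).
Hypothesis LD : forall a b, L a -> L b -> L (fun z => a z + b z).
Hypothesis LZ : forall c a, L a -> L (fun z => c * a z).

Lemma cos_span_cst (c : R) : cos_span (cst c).
Proof.
rewrite (_ : cst c = fun z => c * cos (cst 0 z)).
  exact/cos_spanZ/cos_span_cos.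
by apply/funext => z; rewrite cos0 mulr1.
Qed.

(** cos a cos b = (cos (a + b) + cos (a - b)) / 2. *)
Lemma cos_spanM h k : cos_span h -> cos_span k -> cos_span (fun z => h z * k z).
Proof.
move=> hP; elim: hP k => [l Ll|h1 h2 _ IH1 _ IH2|c h1 _ IH] k kP.
- elim: kP => [m Lm|k1 k2 _ IH1 _ IH2|c k1 _ IH].
  + rewrite (_ : (fun z => _) = fun z => 2^-1 * (cos (l z + m z) +
      cos (l z + -1 * m z))).
      apply/cos_spanZ/cos_spanD; apply: cos_span_cos; apply: LD => //.
      exact: LZ.
    by apply/funext => z; rewrite mulN1r cosD cosB; field.
  + rewrite (_ : (fun z => _) = fun z => cos (l z) * k1 z + cos (l z) * k2 z).
      exact: cos_spanD.
    by apply/funext => z; rewrite mulrDr.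
  + rewrite (_ : (fun z => _) = fun z => c * (cos (l z) * k1 z)).
      exact: cos_spanZ.
    by apply/funext => z; rewrite mulrCA.
- rewrite (_ : (fun z => _) = fun z => h1 z * k z + h2 z * k z).
    by apply: cos_spanD; [exact: IH1|exact: IH2].
  by apply/funext => z; rewrite mulrDl.
- rewrite (_ : (fun z => _) = fun z => c * (h1 z * k z)).
    by apply: cos_spanZ; exact: IH.
  by apply/funext => z; rewrite mulrA.
Qed.

Lemma cos_span_uniform h : cos_span h -> uniform_cos_span h.
Proof.
by move=> hP e /ltW e0; exists h => // z; rewrite subrr normr0.
Qed.

Lemma uniform_cos_spanD h k : uniform_cos_span h -> uniform_cos_span k ->
  uniform_cos_span (fun z => h z + k z).
Proof.
move=> hU kU e e0; have e20 : 0 < e / 2 by rewrite divr_gt0.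
have [h' h'P hh'] := hU _ e20; have [k' k'P kk'] := kU _ e20.
exists (fun z => h' z + k' z); first exact: cos_spanD.
move=> z; rewrite opprD addrACA (le_trans (ler_normD _ _))//.
by rewrite [e in leRHS]splitr lerD.
Qed.

Lemma uniform_cos_spanZ c h : uniform_cos_span h ->
  uniform_cos_span (fun z => c * h z).
Proof.
move=> hU e e0; have c0 : 0 < `|c| + 1 by rewrite ltr_pwDr.
have [|h' h'P hh'] := hU (e / (`|c| + 1)); first by rewrite divr_gt0.
exists (fun z => c * h' z); first exact: cos_spanZ.
move=> z; rewrite -mulrBr normrM.
apply: (@le_trans _ _ ((`|c| + 1) * `|h z - h' z|)).
  by rewrite ler_wpM2r// lerDl.
by rewrite mulrC -ler_pdivlMr.
Qed.

(** An element of the span is bounded, so that after rescaling to [-1, 1] the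
polynomial approximation of the absolute value applies to it. *)
Lemma cos_span_abs h : cos_span h -> uniform_cos_span (fun z => `|h z|).
Proof.
move=> hP e e0; have [B B0 hB] := cos_span_bounded hP.
pose N := (Num.truncn (2 * B / e)).+1.
exists (fun z => B * abs_approx (B^-1 * h z) N).
  apply: cos_spanZ; elim: N => [|N IH] /=; first exact: cos_span_cst.
  rewrite (_ : (fun z => _) = (fun z => abs_approx (B^-1 * h z) N + 2^-1 *
    ((B^-1 * h z) * (B^-1 * h z) + -1 *
      (abs_approx (B^-1 * h z) N * abs_approx (B^-1 * h z) N)))).
    apply: cos_spanD => //; apply: cos_spanZ; apply: cos_spanD.
      by apply: cos_spanM; exact: cos_spanZ.
    by apply: cos_spanZ; exact: cos_spanM.
  by apply/funext => z; rewrite !expr2 mulN1r; congr (_ + _); exact: mulrC.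
move=> z; set y := B^-1 * h z.
have hE : h z = B * y by rewrite mulrA divff ?mul1r// gt_eqF.
have y1 : `|y| <= 1.
  by rewrite normrM gtr0_norm ?invr_gt0// mulrC ler_pdivrMr// mul1r.
have [d0 dN] := abs_approxP N y1.
rewrite hE normrM (gtr0_norm B0) -mulrBr normrM (gtr0_norm B0) (ger0_norm d0).
have N0 : 0 < N%:R :> R by rewrite ltr0n.
rewrite -(ler_pM2r N0) -mulrA (le_trans (ler_wpM2l (ltW B0) dN))//.
rewrite [B * 2]mulrC [e * _]mulrC -ler_pdivrMr//.
by apply: ltW; exact: truncnS_gt.
Qed.

Lemma uniform_cos_span_abs h : uniform_cos_span h ->
  uniform_cos_span (fun z => `|h z|).
Proof.
move=> hU e e0; have e20 : 0 < e / 2 by rewrite divr_gt0.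
have [h' h'P hh'] := hU _ e20; have [k kP hk] := cos_span_abs h'P e20.
exists k => // z; rewrite -[_ - _](subrKA (`|h' z|)) (le_trans (ler_normD _ _))//.
rewrite [e in leRHS]splitr lerD//.
by rewrite (le_trans (ler_dist_dist _ _)).
Qed.

Lemma uniform_cos_span_max h k : uniform_cos_span h -> uniform_cos_span k ->
  uniform_cos_span (fun z => Num.max (h z) (k z)).
Proof.
move=> hU kU; rewrite (_ : (fun z => _) =
    fun z => 2^-1 * (h z + k z + `|h z + -1 * k z|)).
  apply: uniform_cos_spanZ; apply: uniform_cos_spanD.
    exact: uniform_cos_spanD.
  by apply/uniform_cos_span_abs/uniform_cos_spanD => //; exact: uniform_cos_spanZ.
by apply/funext => z; rewrite mulN1r maxr_absE mulrC.
Qed.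

Lemma uniform_cos_span_min h k : uniform_cos_span h -> uniform_cos_span k ->
  uniform_cos_span (fun z => Num.min (h z) (k z)).
Proof.
move=> hU kU; rewrite (_ : (fun z => _) =
    fun z => -1 * Num.max (-1 * h z) (-1 * k z)).
  by apply/uniform_cos_spanZ/uniform_cos_span_max; exact: uniform_cos_spanZ.
by apply/funext => z; rewrite !mulN1r oppr_max !opprK.
Qed.

End cos_span.

Section stone_weierstrass.
Variables (R : realType) (E : topologicalType) (L : set (E -> R)).
Hypothesis Lcst : forall c : R, L (cst c).
Hypothesis LD : forall a b, L a -> L b -> L (fun z => a z + b z).
Hypothesis LZ : forall c a, L a -> L (fun z => c * a z).
Hypothesis Lcont : forall a, L a -> continuous a.
Variables (K : set E) (F : E -> R).
Hypothesis cK : compact K.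
Hypothesis cF : forall x, K x -> F z @[z --> within K (nbhs x)] --> F x.
Hypothesis Fsep : forall x y, K x -> K y -> (forall l, L l -> l x = l y) ->
  F x = F y.

Let lat (h : E -> R) := uniform_cos_span L h /\ continuous h.

Let lat_cst (c : R) : lat (cst c).
Proof.
by split; [exact/cos_span_uniform/cos_span_cst|move=> x; exact: cvg_cst].
Qed.

Let lat_max h k : lat h -> lat k -> lat (fun z => Num.max (h z) (k z)).
Proof.
move=> [hU hc] [kU kc]; split; first exact: uniform_cos_span_max.
by move=> z; apply: continuous_max; [exact: hc|exact: kc].
Qed.

Let lat_min h k : lat h -> lat k -> lat (fun z => Num.min (h z) (k z)).
Proof.
move=> [hU hc] [kU kc]; split; first exact: uniform_cos_span_min.
by move=> z; apply: continuous_min; [exact: hc|exact: kc].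
Qed.

(** If some [l] distinguishes [x] from [y], an affine change of [l] makes it 0
at [x] and pi at [y], where the cosine is 1 and -1. *)
Let lat_interpolate x y : K x -> K y ->
  exists h, [/\ lat h, h x = F x & h y = F y].
Proof.
move=> Kx Ky; have [sep|] := pselect (forall l, L l -> l x = l y).
  by exists (cst (F x)); split; [exact: lat_cst|by []|exact: Fsep].
move=> /existsNP[l /not_implyP[Ll /eqP lxy]].
have d0 : l y - l x != 0 by rewrite subr_eq0 eq_sym.
pose m z := pi / (l y - l x) * (l z + - l x).
have Lm : L m by apply: LZ; apply: (LD (b := cst (- l x))).
exists (fun z => (F x + F y) / 2 + (F x - F y) / 2 * cos (m z)); split.
- split.
    apply: cos_span_uniform; apply: cos_spanD; first exact: cos_span_cst.
    by apply: cos_spanZ; exact: cos_span_cos.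
  move=> z; apply: cvgD; first exact: cvg_cst.
  apply: cvgM; first exact: cvg_cst.
  apply: (@continuous_comp _ _ _ m (@cos R)); [exact: Lcont|exact: continuous_cos].
- by rewrite /m subrr mulr0 cos0; field.
- by rewrite /m divfK// cospi; field.
Qed.

Let near_dist h y e : lat h -> K y -> h y = F y -> 0 < e ->
  \forall z \near within K (nbhs y), `|h z - F z| < e.
Proof.
move=> lh Ky hy e0.
have cd : (h z - F z) @[z --> within K (nbhs y)] --> (0 : R).
  rewrite -(subrr (F y)) -{1}hy; apply: cvgB; last exact: cF.
  apply: cvg_within_filter; exact: lh.2.
exact: (cvgr0_norm_lt _ cd).
Qed.

(** A minimum of finitely many interpolating functions, one for each member of
a covering of [K], stays below F + e and still agrees with [F] at [x]. *)
Let lat_above x e : K x -> 0 < e ->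
  exists h, [/\ lat h, h x = F x & forall z, K z -> h z < F z + e].
Proof.
move=> Kx e0; pose Q V := exists h, [/\ lat h, h x = F x &
  forall z, V z -> h z < F z + e].
suff : Q K by [].
apply: compact_induction => //.
- by exists (cst (F x)); split.
- by move=> A B AB [h [lh hx hB]]; exists h; split => // z /AB /hB.
- move=> A B [h [lh hx hA]] [k [lk kx kB]].
  exists (fun z => Num.min (h z) (k z)); split.
  + exact: lat_min.
  + by rewrite hx kx minxx.
  + by move=> z [/hA|/kB] ?; rewrite gt_min; apply/orP; [left|right].
- move=> y Ky; have [h [lh hx hy]] := lat_interpolate Kx Ky.
  exists (fun z => K z -> `|h z - F z| < e); first exact: (near_dist lh).
  exists h; split => // z [Vz Kz]; have := Vz Kz.
  by rewrite -ltrBlDl; apply: le_lt_trans; exact: ler_norm.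
Qed.

(** Dually, a maximum of finitely many functions given by [lat_above] is also
above F - e. *)
Lemma stone_weierstrass e : 0 < e ->
  exists2 h, uniform_cos_span L h & forall z, K z -> `|h z - F z| <= e.
Proof.
move=> e0; pose Q V := exists h, [/\ lat h, forall z, K z -> h z < F z + e &
  forall z, V z -> F z - e < h z].
suff [h [[hU _] h1 h2]] : Q K.
  exists h => // z Kz; rewrite ler_distl ltW ?h2//=.
  exact/ltW/h1.
apply: compact_induction => //.
- have [[x Kx]|K0] := pselect (exists x, K x).
    by have [h [lh hx hK]] := lat_above Kx e0; exists h; split.
  exists (cst 0); split => // z Kz; exfalso; apply: K0; by exists z.
- by move=> A B AB [h [lh hx hB]]; exists h; split => // z /AB /hB.
- move=> A B [h [lh hK hA]] [k [lk kK kB]].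
  exists (fun z => Num.max (h z) (k z)); split.
  + exact: lat_max.
  + by move=> z Kz; rewrite gt_max hK// kK.
  + by move=> z [/hA|/kB] ?; rewrite lt_max; apply/orP; [left|right].
- move=> y Ky; have [h [lh hy hK]] := lat_above Ky e0.
  exists (fun z => K z -> `|h z - F z| < e); first exact: (near_dist lh).
  exists h; split => // z [Vz Kz]; have := Vz Kz.
  by rewrite ltr_distl => /andP[].
Qed.

Lemma clamp_dist (a b u v : R) : a <= b ->
  `|clamp a b u - clamp a b v| <= `|u - v|.
Proof.
move=> ab; wlog uv : u v / u <= v => [h|].
  by have [/h//|/ltW/h] := leP u v; rewrite distrC (distrC u).
rewrite distrC (distrC u) (@ger0_norm _ (v - u)) ?subr_ge0//.
have [->|[h1 h2 h3]] := clampP ab uv; first by rewrite subrr normr0 subr_ge0.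
by rewrite ger0_norm; lra.
Qed.

(** Truncating the approximation keeps it in the lattice and bounds it on all of
[E], not only on [K]. *)
Lemma stone_weierstrass_clamp (B e : R) : 0 <= B -> 0 < e ->
  exists k, [/\ cos_span L k, forall z, `|k z| <= B + e &
    forall z, K z -> `|k z - clamp (- B) B (F z)| <= e].
Proof.
move=> B0 e0; have e20 : 0 < e / 2 by rewrite divr_gt0.
have BB : - B <= B by lra.
have [h hU hF] := stone_weierstrass e20.
have cU : uniform_cos_span L (fun z => clamp (- B) B (h z)).
  apply: uniform_cos_span_min => //; first exact/cos_span_uniform/cos_span_cst.
  by apply: uniform_cos_span_max => //; exact/cos_span_uniform/cos_span_cst.
have [k kP hk] := cU _ e20; exists k; split => // z; last first.
  move=> Kz; rewrite distrC -[_ - _](subrKA (clamp (- B) B (h z))).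
  rewrite (le_trans (ler_normD _ _))// [e in leRHS]splitr lerD//.
  by rewrite (le_trans (clamp_dist _ _ BB))// distrC hF.
rewrite -[k z](subrK (clamp (- B) B (h z))) (le_trans (ler_normD _ _))//.
rewrite addrC lerD//; last by rewrite distrC (le_trans (hk z))// ler_piMr// ?ltW; lra.
by rewrite ler_norml; exact: clamp_itv.
Qed.

End stone_weierstrass.

(** * Convergence in L^p *)

Section power_mean.
Variables (R : realType) (p : R).
Hypothesis p1 : 1 <= p.
Let p0 : 0 <= p := le_trans ler01 p1.

Lemma powR_le (x y : R) : 0 <= x -> x <= y -> x `^ p <= y `^ p.
Proof.
by move=> x0 xy; apply: ge0_ler_powR => //; rewrite nnegrE// (le_trans x0).
Qed.

(** The constant is crude, but only the smallness of distances matters in what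
follows; it comes from bounding a sum by twice its larger term. *)
Lemma powR_dist_triangle (x y z : R) :
  `|x - z| `^ p <= 2 `^ p * (`|x - y| `^ p + `|y - z| `^ p).
Proof.
have tri := ler_distD y x z.
wlog h : x z tri / `|x - y| <= `|y - z| => [wl|].
  have [/wl|/ltW h] := leP `|x - y| `|y - z|; first exact.
  have := wl z x; rewrite (distrC z x) (distrC z y) (distrC y x) => w.
  rewrite [_ + `|y - z| `^ p]addrC; apply: w => //.
  by rewrite [`|y - z| + _]addrC.
apply: (@le_trans _ _ ((2 * `|y - z|) `^ p)).
  by apply: powR_le => //; rewrite (le_trans tri)// mulr_natl mulr2n lerD2r.
by rewrite powRM// ler_wpM2l ?powR_ge0// lerDr powR_ge0.
Qed.

Lemma powR_small (x e : R) : 0 < e -> 0 <= x -> x <= 1 -> x <= e -> x `^ p <= e.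
Proof.
move=> e0 x0 x1 xe; have [->|xn0] := eqVneq x 0.
  by rewrite powR0 ?ltW// gt_eqF// (lt_le_trans _ p1).
apply: le_trans xe; apply: ge1r_powR => //.
by rewrite x1 andbT lt_neqAle eq_sym xn0.
Qed.

Lemma cvg_powR (u : nat -> R) (l : R) : (forall n, 0 <= u n) ->
  u n @[n --> \oo] --> l -> u n `^ p @[n --> \oo] --> l `^ p.
Proof.
move=> u0 ul; have l0 : 0 <= l.
  by rewrite -(cvg_lim _ ul)//; apply: limr_ge => //; [apply/cvg_ex; exists l|near=> n].
have [l00|ln0] := eqVneq l 0; last first.
  have lp : 0 < l by rewrite lt_neqAle eq_sym ln0.
  apply: (@cvg_comp _ _ _ u (fun a => a `^ p) _ _ _ ul).
  suff : {for l, continuous (fun a : R => a `^ p)} by [].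
  apply: differentiable_continuous; apply/derivable1_diffP.
  by apply: derivable_powR; rewrite in_itv/= lp.
rewrite l00 powR0 ?gt_eqF ?(lt_le_trans _ p1)//; rewrite l00 in ul.
apply/cvgr0Pnorm_le => e e0; near=> n.
rewrite ger0_norm ?powR_ge0//; apply: powR_small => //.
  rewrite -[leLHS]ger0_norm//; near: n; exact: cvgr0_norm_le.
rewrite -[leLHS]ger0_norm//; near: n; exact: cvgr0_norm_le.
Unshelve. all: by end_near.
Qed.

End power_mean.

Section lp_dist.
Variables (R : realType) (disp : measure_display) (S : measurableType disp).
Variables (mu : {measure set S -> \bar R}) (D : set S) (p : R).
Hypothesis p1 : 1 <= p.
Hypothesis mD : measurable D.
Hypothesis muD : (mu D < +oo)%E.
Implicit Types f g h k : S -> R.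

(** The p-th power of the L^p distance over [D]. *)
Definition lp_dist f g : \bar R := (\int[mu]_(z in D) (`|f z - g z| `^ p)%:E)%E.

Lemma measurable_dist_powR f g : measurable_fun D f -> measurable_fun D g ->
  measurable_fun D (fun z => (`|f z - g z| `^ p)%:E).
Proof.
move=> mf mg; apply/measurable_EFinP.
apply: (measurableT_comp (measurable_powR p)).
by apply: measurableT_comp => //; exact: measurable_funB.
Qed.

Lemma lp_distC f g : lp_dist f g = lp_dist g f.
Proof. by apply: eq_integral => z _; rewrite distrC. Qed.

Lemma lp_distxx f : lp_dist f f = 0%E.
Proof.
apply: integral0_eq => z _; rewrite subrr normr0 powR0// gt_eqF//.
exact: lt_le_trans p1.
Qed.

Lemma eq_lp_dist f g f' g' : {in D, f =1 f'} -> {in D, g =1 g'} ->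
  lp_dist f g = lp_dist f' g'.
Proof. by move=> ff gg; apply: eq_integral => z zD; rewrite ff// gg. Qed.

Lemma lp_dist_triangle f g h : measurable_fun D f -> measurable_fun D g ->
  measurable_fun D h ->
  (lp_dist f h <= (2 `^ p)%:E * (lp_dist f g + lp_dist g h))%E.
Proof.
move=> mf mg mh; have mfg := measurable_dist_powR mf mg.
have mgh := measurable_dist_powR mg mh.
rewrite -ge0_integralD//; [|by move=> z _; rewrite lee_fin powR_ge0..].
rewrite -ge0_integralZl//; last 2 first.
- exact: emeasurable_funD.
- by move=> z _; rewrite adde_ge0// lee_fin powR_ge0.
apply: ge0_le_integral => //.
- exact: measurable_dist_powR.
- by apply: measurable_funeM; exact: emeasurable_funD.
- move=> z _; rewrite -EFinD -EFinM lee_fin; exact: powR_dist_triangle.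
Qed.

(** Smallness is preserved along three successive steps: with C = 2^p >= 1 the
two triangle inequalities cost C (eta + 2 C eta), less than 4 C^2 eta. *)
Lemma lp_dist_chain (e : R) : 0 < e -> exists2 eta : R, 0 < eta &
  forall f g h k, measurable_fun D f -> measurable_fun D g ->
    measurable_fun D h -> measurable_fun D k ->
    (lp_dist f g <= eta%:E)%E -> (lp_dist g h <= eta%:E)%E ->
    (lp_dist h k <= eta%:E)%E -> (lp_dist f k < e%:E)%E.
Proof.
move=> e0; pose C : R := 2 `^ p; have C0 : 0 < C by rewrite powR_gt0.
have C1 : 1 <= C by apply: le_trans (le1r_powR _ p1); rewrite ler1n.
exists (e / (4 * C ^+ 2)); first by rewrite divr_gt0// mulr_gt0// exprn_gt0.
set eta := _ / _ => f g h k mf mg mh mk fg gh hk.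
apply: le_lt_trans (lp_dist_triangle mf mg mk) _.
have C0' : (0 <= C%:E)%E by rewrite lee_fin ltW.
have gk : (lp_dist g k <= C%:E * (eta%:E + eta%:E))%E.
  apply: le_trans (lp_dist_triangle mg mh mk) _.
  exact: (lee_wpmul2l C0' (leeD gh hk)).
apply: (@le_lt_trans _ _ (C%:E * (eta%:E + C%:E * (eta%:E + eta%:E)))%E).
  exact: (lee_wpmul2l C0' (leeD fg gk)).
suff : ((C * (eta + C * (eta + eta)))%:E < e%:E)%E by [].
have eta0 : 0 < eta by rewrite divr_gt0// mulr_gt0// exprn_gt0.
have eE : e = eta * (4 * C ^+ 2) by rewrite /eta divfK// mulf_neq0// ?expf_eq0 gt_eqF.
rewrite lte_fin eE; nra.
Qed.

Lemma lp_dist_dominated (f_ : nat -> S -> R) f g :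
  (forall n, measurable_fun D (f_ n)) -> measurable_fun D f ->
  measurable_fun D g ->
  (\int[mu]_(z in D) (g z)%:E < +oo)%E ->
  (forall n z, D z -> `|f z - f_ n z| `^ p <= g z) ->
  (forall z, D z -> f_ n z @[n --> \oo] --> f z) ->
  forall e : R, 0 < e -> exists N, forall n, (N <= n)%N ->
    (lp_dist f (f_ n) < e%:E)%E.
Proof.
move=> mf_ mf mg ig fg f_f e e0.
have g0 z : D z -> 0 <= g z.
  by move=> Dz; apply: le_trans (fg 0%N z Dz); exact: powR_ge0.
have := @dominated_convergence _ _ _ mu D mD
  (fun n z => (`|f z - f_ n z| `^ p)%:E) (cst 0%E) (EFin \o g).
case.
- by move=> n; exact: measurable_dist_powR.
- exact: measurable_cst.
- apply: aeW => z Dz; apply: cvg_EFin; first by near=> n.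
  apply/cvgr0Pnorm_le => d d0; near=> n => /=.
  rewrite ger0_norm ?powR_ge0//; apply: powR_small => //.
    near: n; apply: cvgr_dist_le (f_f z Dz) _ _; exact: ltr01.
  near: n; exact: cvgr_dist_le (f_f z Dz) _ _.
- apply/integrableP; split; first exact/measurable_EFinP.
  rewrite (eq_integral (EFin \o g))// => z zD.
  by rewrite gee0_abs// lee_fin g0//; exact: set_mem.
- apply: aeW => z n Dz; rewrite gee0_abs ?lee_fin ?powR_ge0//; exact: fg.
move=> _ _; rewrite integral0 => /fine_cvgP[fin /cvgr0Pnorm_lt/(_ _ e0)] lt_e.
have [N _ HN] : \forall n \near \oo, (lp_dist f (f_ n) < e%:E)%E.
  near=> n; rewrite -[lp_dist _ _]fineK; last by near: n; exact: fin.
  rewrite lte_fin (le_lt_trans (ler_norm _))//; near: n; exact: lt_e.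
by exists N.
Unshelve. all: by end_near.
Qed.

Lemma measurable_clamp f (a b : R) : measurable_fun D f ->
  measurable_fun D (fun z => clamp a b (f z)).
Proof.
move=> mf; apply: measurable_minr; first exact: measurable_cst.
by apply: measurable_maxr => //; exact: measurable_cst.
Qed.

Lemma clamp_norm_le (B t : R) : 0 <= B -> `|clamp (- B) B t| <= B.
Proof. by move=> B0; rewrite ler_norml; apply: clamp_itv; lra. Qed.

Lemma clamp_id (B t : R) : `|t| <= B -> clamp (- B) B t = t.
Proof.
by rewrite ler_norml => /andP[h1 h2]; rewrite /clamp max_r// min_r.
Qed.

Lemma clamp_dist_le (B t : R) : 0 <= B -> `|t - clamp (- B) B t| <= `|t|.
Proof.
move=> B0; have [/clamp_id ->|] := leP `|t| B; first by rewrite subrr normr0.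
rewrite /clamp; have [t0|t0] := leP 0 t.
  rewrite ger0_norm// => Bt; rewrite max_r ?min_l; [|lra..].
  by rewrite ger0_norm; lra.
rewrite ltr0_norm// => Bt; rewrite max_l ?min_r; [|lra..].
by rewrite ler0_norm; lra.
Qed.

Lemma clamp_cvg (u : nat -> R) (l a b : R) : u n @[n --> \oo] --> l ->
  clamp a b (u n) @[n --> \oo] --> clamp a b l.
Proof.
move=> ul; apply: (@cvg_comp _ _ _ u (clamp a b) _ _ _ ul).
suff : {for l, continuous (clamp a b)} by [].
apply: continuous_min; first exact: cvg_cst.
by apply: continuous_max => //; exact: cvg_cst.
Qed.

Lemma integral_cst_lty (c : R) : (\int[mu]_(z in D) (cst c z)%:E < +oo)%E.
Proof.
have -> : (fun z => (cst c z)%:E) = cst (c%:E : \bar R) by [].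
rewrite integral_cst//; have [c0|c0] := leP 0 c.
  by rewrite lte_mul_pinfty// ?lee_fin.
by rewrite (@le_lt_trans _ _ 0%E)// mule_le0_ge0// lee_fin ltW.
Qed.

(** Truncating at level B = K^(1/p) changes [f] only where |f|^p is at
least [K], and there by at most |f|: tails of |f|^p control the distance to the
truncation. *)
Lemma lp_dist_clamp_le f (B K : R) : measurable_fun D f -> 0 < K ->
  B = K `^ p^-1 ->
  (lp_dist f (fun z => clamp (- B) B (f z)) <=
   \int[mu]_(z in D `&` [set z | (K <= `|f z| `^ p)%R]) (`|f z| `^ p)%:E)%E.
Proof.
move=> mf K0 BE; have p0 : 0 < p by rewrite (lt_le_trans _ p1).
have B0 : 0 < B by rewrite BE powR_gt0.
have BK : B `^ p = K by rewrite BE -powRrM mulVf ?gt_eqF// powRr1// ltW.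
have mfp : measurable_fun D (fun z => `|f z| `^ p).
  apply: (measurableT_comp (measurable_powR p)).
  exact: measurableT_comp.
set A := D `&` _; have mA : measurable A.
  rewrite (_ : A = D `&` (fun z => `|f z| `^ p) @^-1` `[K, +oo[).
    by apply: mfp => //; exact: measurable_itv.
  by apply/seteqP; split => z [Dz] /=; rewrite in_itv/= andbT.
have mdf := measurable_dist_powR mf (@measurable_clamp f (- B) B mf).
have -> : lp_dist f (fun z => clamp (- B) B (f z)) =
    (\int[mu]_(z in A) (`|f z - clamp (- B) B (f z)| `^ p)%:E)%E.
  rewrite /A integral_mkcondr; apply: eq_integral => z zD.
  rewrite patchE; case: ifPn => // /negP zP.
  rewrite clamp_id ?subrr ?normr0 ?powR0 ?gt_eqF//.
  rewrite leNgt; apply/negP => Bz; apply: zP; rewrite inE/= -BK.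
  by apply: powR_le => //; exact: ltW.
apply: ge0_le_integral => //.
- by apply: measurable_funS mdf => // z [].
- by apply/measurable_EFinP; apply: measurable_funS mfp => // z [].
- move=> z _; rewrite lee_fin; apply: powR_le => //; apply: clamp_dist_le.
  exact: ltW.
Qed.

(** Uniform integrability enters as uniform closeness to truncations.  Fatou's
lemma passes it to the limit, and the truncations converge by dominated
convergence, since constants are integrable on [D]. *)
Lemma vitali (f_ : nat -> S -> R) f :
  (forall n, measurable_fun D (f_ n)) -> measurable_fun D f ->
  (forall z, D z -> f_ n z @[n --> \oo] --> f z) ->
  (forall e : R, 0 < e -> exists2 B : R, 0 <= B & forall n,
    (lp_dist (f_ n) (fun z => clamp (- B) B (f_ n z)) <= e%:E)%E) ->
  forall e : R, 0 < e -> exists N, forall n, (N <= n)%N ->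
    (lp_dist f (f_ n) < e%:E)%E.
Proof.
move=> mf_ mf f_f ui e e0; have [eta eta0 chain] := lp_dist_chain e0.
have [B B0 tail] := ui _ eta0; pose c t := clamp (- B) B t.
have mc g : measurable_fun D g -> measurable_fun D (fun z => c (g z)).
  exact: measurable_clamp.
have ftail : (lp_dist f (fun z => c (f z)) <= eta%:E)%E.
  pose h n z := (`|f_ n z - c (f_ n z)| `^ p)%:E.
  have mh n : measurable_fun D (h n) by apply: measurable_dist_powR => //; exact: mc.
  have h0 n z : D z -> (0 <= h n z)%E by rewrite lee_fin powR_ge0.
  have hl z : D z -> limn_einf (h^~ z) = (`|f z - c (f z)| `^ p)%:E.
    move=> Dz; have hz : h n z @[n --> \oo] --> (`|f z - c (f z)| `^ p)%:E.
      apply: cvg_EFin; first by near=> n.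
      apply: (@cvg_powR _ _ p1 (fun n => `|f_ n z - c (f_ n z)|)) => //.
      apply: cvg_norm; apply: cvgB; first exact: f_f.
      exact/clamp_cvg/f_f.
    by rewrite is_cvg_limn_einfE; [exact/cvg_lim|apply/cvg_ex; eexists; exact: hz].
  have := fatou mu mD mh h0; rewrite (eq_integral _ _ (fun z zD => hl z (set_mem zD))).
  move/le_trans; apply; rewrite limn_einf_lim.
  apply: lime_le; first exact: is_cvg_einfs.
  near=> n; apply: le_trans (tail n); apply: ereal_inf_lbound.
  by exists n => //=.
have [||N HN] := @lp_dist_dominated (fun n z => c (f_ n z)) (fun z => c (f z))
  (cst ((2 * B) `^ p)) (fun n => mc _ (mf_ n)) (mc _ mf) (measurable_cst _)
  (integral_cst_lty _) _ _ _ eta0.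
- move=> n z Dz; apply: powR_le => //.
  rewrite (le_trans (ler_normB _ _))// mulr_natl mulr2n lerD//;
  exact: clamp_norm_le.
- by move=> z Dz; exact/clamp_cvg/f_f.
exists N => n Nn.
have tail_n : (lp_dist (fun z => c (f_ n z)) (f_ n) <= eta%:E)%E.
  by rewrite lp_distC; exact: tail.
exact: (chain _ _ _ _ mf (mc _ mf) (mc _ (mf_ n)) (mf_ n) ftail
  (ltW (HN n Nn)) tail_n).
Unshelve. all: by end_near.
Qed.

End lp_dist.

(** * L^p density of algebras with exponentially integrable generators *)

Section lp_density.
Variables (R : realType) (disp : measure_display) (S : measurableType disp).
Variables (mu : {measure set S -> \bar R}) (D : set S) (p : R).
Hypothesis p1 : 1 <= p.
Hypothesis mD : measurable D.
Hypothesis muD : (mu D < +oo)%E.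
Variables (E : topologicalType) (Theta : S -> E).
Variables (L A : set (E -> R)).
Hypothesis Lcst : forall c : R, L (cst c).
Hypothesis LD : forall a b, L a -> L b -> L (fun z => a z + b z).
Hypothesis LZ : forall c a, L a -> L (fun z => c * a z).
Hypothesis Lcont : forall a, L a -> continuous a.
Hypothesis Lexp : forall a, L a ->
  (\int[mu]_(z in D) (expR `|a (Theta z)|)%:E < +oo)%E.
Hypothesis LA : L `<=` A.
Hypothesis AD : forall a b, A a -> A b -> A (fun z => a z + b z).
Hypothesis AM : forall a b, A a -> A b -> A (fun z => a z * b z).
Hypothesis Ameas : forall a, A a -> measurable_fun D (a \o Theta).

Let dist (f g : E -> R) : \bar R := lp_dist mu D p (f \o Theta) (g \o Theta).
Let approx (h : E -> R) := measurable_fun D (h \o Theta) /\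
  forall e : R, 0 < e -> exists2 a, A a & (dist h a < e%:E)%E.

(** The Taylor sums of the cosine are dominated by the exponential of the
absolute value, whatever their length. *)
Lemma cos_partial_sum_le (x : R) n :
  `|series (cos_coeff x) n| <= expR `|x|.
Proof.
rewrite /series/= (le_trans (ler_norm_sum _ _ _))//.
apply: (@le_trans _ _ (series (exp_coeff `|x|) n)).
  apply: ler_sum => k _; rewrite /cos_coeff /exp_coeff/= !normrM.
  rewrite normfV !normrX !normr_nat.
  rewrite ler_wpM2r ?invr_ge0// ler_piMl// ?exprn_ge0//.
  by rewrite normrN normr1 expr1n mulr1; case: (odd k).
apply: nondecreasing_cvgn_le; last exact: is_cvg_series_exp_coeff.
apply: nondecreasing_series => k _ _; rewrite /exp_coeff/=.
by rewrite divr_ge0// exprn_ge0.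
Qed.

(** Here lies the use of exponential moments: the distance between cos l and its
Taylor sums is dominated by 2^p exp (p |l|). *)
Let approx_cos l : L l -> approx (fun z => cos (l z)).
Proof.
move=> Ll; have ml := Ameas (LA Ll).
have mc : measurable_fun D ((fun z => cos (l z)) \o Theta).
  apply: (@measurable_comp _ _ _ _ _ _ setT (@cos R)) ml => //.
  by apply: continuous_measurable_fun; exact: continuous_cos.
split => // e e0.
have AP n : A (fun z => series (cos_coeff (l z)) n).
  have AX k : A (fun z => l z ^+ k).
    elim: k => [|k IH]; first exact: LA (Lcst 1).
    rewrite (_ : (fun z => _) = fun z => l z * l z ^+ k); first exact: AM (LA Ll) IH.
    by apply/funext => z; rewrite exprS.
  elim: n => [|n IH].
    rewrite (_ : (fun z => _) = cst 0); first exact: LA (Lcst 0).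
    by apply/funext => z; rewrite /series/= big_geq.
  rewrite (_ : (fun z => _) = fun z => series (cos_coeff (l z)) n +
    cst ((~~ odd n)%:R * (-1) ^+ n./2 / n`!%:R) z * l z ^+ n).
    by apply: AD => //; apply: AM => //; exact: LA (Lcst _).
  by apply/funext => z; rewrite seriesSr /cos_coeff/= -!exprnP mulrAC.
have lp : L (fun z => p * l z) by exact: LZ.
have mexp : measurable_fun D (fun z => expR `|p * l (Theta z)|).
  apply: (measurableT_comp (@measurable_expR R)).
  by apply: measurableT_comp => //; exact: Ameas (LA lp).
have [|||||N HN] := @lp_dist_dominated _ _ _ mu D p p1 mD
  (fun n z => series (cos_coeff (l (Theta z))) n)
  ((fun z => cos (l z)) \o Theta)
  (fun z => 2 `^ p * expR `|p * l (Theta z)|) _ mc _ _ _ _ e e0.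
- by move=> n; exact: Ameas (AP n).
- by apply: measurable_funM => //; exact: measurable_cst.
- under eq_integral do rewrite EFinM.
  rewrite ge0_integralZl//; last exact/measurable_EFinP.
  rewrite lte_mul_pinfty// ?lee_fin ?powR_ge0//; exact: Lexp lp.
- move=> n z Dz.
  have -> : expR `|p * l (Theta z)| = expR `|l (Theta z)| `^ p.
    by rewrite normrM ger0_norm ?(le_trans ler01 p1)// mulrC expRM.
  rewrite -powRM ?expR_ge0//; apply: powR_le => //.
  rewrite (le_trans (ler_normB _ _))// mulr_natl mulr2n lerD//; last first.
    exact: cos_partial_sum_le.
  rewrite (@le_trans _ _ 1)//; first by rewrite ler_norml cos_geN1 cos_le1.
  by rewrite -expR0 ler_expR.
- move=> z Dz; rewrite /= cos.unlock; exact: is_cvg_series_cos_coeff.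
by exists (fun z => series (cos_coeff (l z)) N) => //; exact: HN.
Qed.

Let approxD h k : approx h -> approx k -> approx (fun z => h z + k z).
Proof.
move=> [mh ha] [mk ka]; split; first exact: measurable_funD.
move=> e e0; have [eta eta0 chain] := lp_dist_chain mu p1 mD e0.
have [a Aa hae] := ha _ eta0; have [b Ab kbe] := ka _ eta0.
exists (fun z => a z + b z); first exact: AD.
have ma := Ameas Aa; have mb := Ameas Ab.
apply: (chain _ ((fun z => a z + k z) \o Theta) ((fun z => a z + b z) \o Theta)).
- exact: measurable_funD.
- exact: measurable_funD.
- exact: measurable_funD.
- exact: measurable_funD.
- apply/ltW; apply: le_lt_trans hae; rewrite le_eqVlt; apply/orP; left.
  by apply/eqP/eq_integral => z _; rewrite /= opprD addrACA subrr addr0.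
- apply/ltW; apply: le_lt_trans kbe; rewrite le_eqVlt; apply/orP; left.
  by apply/eqP/eq_integral => z _; rewrite /= opprD addrACA subrr add0r.
- by rewrite lp_distxx// lee_fin ltW.
Qed.

Let approxZ c h : approx h -> approx (fun z => c * h z).
Proof.
move=> [mh ha]; have mch : measurable_fun D ((fun z => c * h z) \o Theta).
  by apply: measurable_funM => //; exact: measurable_cst.
split; first exact: mch.
move=> e e0; pose C := `|c| `^ p + 1.
have C0 : 0 < C by rewrite ltr_pwDr// powR_ge0.
have [|a Aa hae] := ha (e / C); first by rewrite divr_gt0.
exists (fun z => cst c z * a z); first by apply: AM => //; exact: LA (Lcst c).
have mh' := measurable_dist_powR p mh (Ameas Aa).
have -> : dist (fun z => c * h z) (fun z => cst c z * a z) =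
    ((`|c| `^ p)%:E * dist h a)%E.
  rewrite /dist /lp_dist -ge0_integralZl//.
  by apply: eq_integral => z _; rewrite /= -mulrBr normrM powRM// EFinM.
apply: (@le_lt_trans _ _ (C%:E * dist h a)%E).
  by rewrite lee_wpmul2r ?integral_ge0 ?lee_fin ?lerDl// => z _; rewrite lee_fin powR_ge0.
have -> : e%:E = (C%:E * (e / C)%:E)%E by rewrite -EFinM mulrC divfK// gt_eqF.
by rewrite lte_pmul2l ?lte_fin.
Qed.

Let approx_cos_span h : cos_span L h -> approx h.
Proof.
elim=> [l|h1 h2 _ IH1 _ IH2|c h1 _ IH]; [exact: approx_cos|exact: approxD|].
exact: approxZ.
Qed.

Variables (K : nat -> set E) (rho : S -> R) (F : E -> R).
Hypothesis cK : forall N, compact (K N).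
Hypothesis mrho : measurable_fun D rho.
Hypothesis rhoK : forall N z, D z -> rho z <= N%:R -> K N (Theta z).
Hypothesis cF : forall N x, K N x -> F z @[z --> within (K N) (nbhs x)] --> F x.
Hypothesis Fsep : forall N x y, K N x -> K N y ->
  (forall l, L l -> l x = l y) -> F x = F y.
Hypothesis mF : measurable_fun D (F \o Theta).
Hypothesis iF : (\int[mu]_(z in D) (`|F (Theta z)| `^ p)%:E < +oo)%E.

Let mrho_gt (N : nat) : measurable_fun D (fun z => ((N%:R < rho z)%R%:R : R)).
Proof.
rewrite (_ : (fun z => _) = fun z => if N%:R < rho z then 1 else 0 : R).
  apply: measurable_fun_if => //.
  by apply: measurable_fun_ltr => //; exact: measurable_cst.
by apply/funext => z; case: ifP.
Qed.

(** Convergence of the indicators of [N < rho] to 0 in L^p, which for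
indicators is convergence of their integrals. *)
Let rho_gt_small (e : R) : 0 < e -> exists N : nat,
  (\int[mu]_(z in D) ((N%:R < rho z)%R%:R)%:E < e%:E)%E.
Proof.
move=> e0; have [|||||N HN] := @lp_dist_dominated _ _ _ mu D p p1 mD
  (fun N z => (N%:R < rho z)%R%:R) (cst 0) (cst 1) mrho_gt
  _ _ _ _ _ e e0.
- exact: measurable_cst.
- exact: measurable_cst.
- exact: integral_cst_lty.
- move=> n z _ /=; rewrite sub0r normrN normr_nat.
  by case: ltP => _; rewrite ?powR1// powR0 ?ler01// gt_eqF// (lt_le_trans _ p1).
- move=> z Dz; apply: cvg_near_cst; exists (Num.truncn (rho z)).+1 => // n /= Hn.
  rewrite ltNge (le_trans (ltW (truncnS_gt _)))// ler_nat//.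
exists N; rewrite (eq_integral (fun z => (`|0 - (N%:R < rho z)%R%:R| `^ p)%:E)).
  exact: HN.
move=> z _; rewrite sub0r normrN normr_nat.
by case: ltP => _; rewrite ?powR1// powR0// gt_eqF// (lt_le_trans _ p1).
Qed.

(** [F] is replaced by its truncation at a level [B], then by an element [k] of
the span of cosines close to it on the compact set [K N], then by an element of
[A].  Outside of [K N] only the bound 2 B + 1 on the difference is available,
and [N] is chosen after [B] to make that region small. *)
Lemma lp_density (e : R) : 0 < e -> exists2 a, A a & (dist F a < e%:E)%E.
Proof.
move=> e0; have [eta eta0 chain] := lp_dist_chain mu p1 mD e0.
have [B B0 HB] : exists2 B : R, 0 <= B &
    (lp_dist mu D p (F \o Theta) (fun z => clamp (- B) B (F (Theta z))) < eta%:E)%E.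
  have [||||N HN] := @lp_dist_dominated _ _ _ mu D p p1 mD
    (fun n z => clamp (- n%:R) n%:R (F (Theta z))) (F \o Theta)
    (fun z => `|F (Theta z)| `^ p) _ mF _ iF _ _ eta eta0.
  - by move=> n; exact: measurable_clamp.
  - apply: (measurableT_comp (measurable_powR p)).
    exact: measurableT_comp.
  - by move=> n z Dz; apply: powR_le => //; exact: clamp_dist_le.
  - move=> z Dz; apply: cvg_near_cst; exists (Num.truncn `|F (Theta z)|).+1 => // n /= Hn.
    rewrite clamp_id// (le_trans (ltW (truncnS_gt _)))// ler_nat//.
  by exists N%:R => //; exact: HN.
(* With d <= 1 a difference of at most d has p-th power at most d; the
   second bound makes the contribution of the compact set at most
   eta / 2. *)
pose d := Num.min 1 (eta / (2 * (fine (mu D) + 1))).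
have muD0 : 0 <= fine (mu D) by exact: fine_ge0.
have muDfin : (mu D) = (fine (mu D))%:E by rewrite fineK// ge0_fin_numE.
have d0 : 0 < d by rewrite lt_min ltr01 divr_gt0// mulr_gt0// ltr_wpDl.
pose M : R := (2 * B + 1) `^ p; have M0 : 0 < M by rewrite powR_gt0// ltr_wpDl// mulr_ge0.
have [|N HN] := @rho_gt_small (eta / (2 * M)); first by rewrite divr_gt0// mulr_gt0.
have [k [kP kB kF]] := stone_weierstrass_clamp Lcst LD LZ Lcont (cK (N := N))
  (cF (N := N)) (Fsep (N := N)) B0 d0.
have [mk ka] := approx_cos_span kP; have [a Aa kae] := ka _ eta0.
exists a => //; apply: (chain _ (fun z => clamp (- B) B (F (Theta z))) (k \o Theta)).
- exact: mF.
- exact: measurable_clamp.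
- exact: mk.
- exact: Ameas.
- exact: ltW.
- have mN := mrho_gt N.
  apply: (@le_trans _ _ (\int[mu]_(z in D) (d%:E + M%:E * ((N%:R < rho z)%R%:R)%:E))%E).
    apply: ge0_le_integral => //.
    + apply: measurable_dist_powR => //; exact: measurable_clamp.
    + apply: emeasurable_funD; first exact: measurable_cst.
      by apply: measurable_funeM; exact/measurable_EFinP.
    + move=> z Dz; rewrite -EFinM -EFinD lee_fin distrC.
      have [Nr|Nr] := ltP; last first.
        rewrite mulr0 addr0; apply: powR_small => //.
        * by rewrite (le_trans (kF _ (rhoK Dz Nr)))// ge_min lexx.
        * by exact: kF _ (rhoK Dz Nr).
      apply: (@le_trans _ _ M); last by rewrite mulr1 lerDr ltW.
      apply: powR_le => //.
      have := kB (Theta z); have := clamp_norm_le (F (Theta z)) B0.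
      have d1 : d <= 1 by rewrite ge_min lexx.
      move=> h1 h2; rewrite (le_trans (ler_normB _ _))//; lra.
  have mN' : measurable_fun D (fun z => ((N%:R < rho z)%R%:R)%:E : \bar R).
    exact/measurable_EFinP.
  have N0 z : D z -> (0 <= ((N%:R < rho z)%R%:R)%:E :> \bar R)%E by rewrite lee_fin.
  have M0' : (0 <= M%:E)%E by rewrite lee_fin ltW.
  have d0' : (0 <= d%:E)%E by rewrite lee_fin ltW.
  rewrite (ge0_integralD mu mD (fun _ _ => d0') (measurable_cst _)
    (fun z Dz => mule_ge0 M0' (N0 z Dz)) (measurable_funeM _ mN')).
  rewrite (ge0_integralZl mu mD mN' N0 M0') [X in (X + _ <= _)%E]integral_cst//.
  rewrite [eta]splitr EFinD leeD//.
  + rewrite muDfin -EFinM lee_fin.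
    rewrite (@le_trans _ _ (eta / (2 * (fine (mu D) + 1)) * fine (mu D)))//.
      by rewrite ler_wpM2r// ge_min lexx orbT.
    move: (fine (mu D)) muD0 => m m0; have m1 : 0 < m + 1 by rewrite ltr_wpDl.
    rewrite (_ : _ * m = eta / 2 * (m / (m + 1))); last by field; rewrite gt_eqF.
    by rewrite ler_piMr ?divr_ge0 ?(ltW eta0)// ler_pdivrMr// mul1r lerDl.
  + apply: (@le_trans _ _ (M%:E * (eta / (2 * M))%:E)%E).
      by apply: lee_wpmul2l => //; exact: ltW.
    rewrite -EFinM lee_fin (_ : M * _ = eta / 2)//.
    by field; rewrite gt_eqF.
- exact: ltW.
Qed.

End lp_density.

(** * Exponential moments of Gaussian variables *)

Section gaussian.
Variables (R : realType).
Local Notation leb := (@lebesgue_measure R).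

(** Completing the square: an exponential tilt of a normal density is, up to a
constant, a shifted normal density. *)
Lemma normal_pdf_expR (m s c x : R) : s != 0 ->
  expR (c * x) * normal_pdf m s x =
  expR (c * m + c ^+ 2 * s ^+ 2 / 2) * normal_pdf (m + c * s ^+ 2) s x.
Proof.
move=> s0; rewrite !normal_pdfE// /normal_fun.
rewrite mulrCA [RHS]mulrCA -!expRD; congr (_ * expR _).
by rewrite -mulr_natr; field.
Qed.

Lemma integral_expR_normal_pdf (m s c : R) : s != 0 ->
  (\int[leb]_x (expR (c * `|x|) * normal_pdf m s x)%:E < +oo)%E.
Proof.
move=> s0; have me (b : R) : measurable_fun [set: R]
    (fun x : R => (expR (b * x) * normal_pdf m s x)%:E).
  apply/measurable_EFinP; apply: measurable_funM; last exact: measurable_normal_pdf.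
  by apply: (measurableT_comp (@measurable_expR R)); exact: measurable_funM.
have ge b x : (0 <= (expR (b * x) * normal_pdf m s x)%:E)%E.
  by rewrite lee_fin mulr_ge0 ?expR_ge0 ?normal_pdf_ge0.
have fin b : (\int[leb]_x (expR (b * x) * normal_pdf m s x)%:E < +oo)%E.
  under eq_integral do rewrite normal_pdf_expR// EFinM.
  rewrite ge0_integralZl ?lee_fin ?expR_ge0//; last 2 first.
  - by apply/measurable_EFinP; exact: measurable_normal_pdf.
  - by move=> x _; rewrite lee_fin normal_pdf_ge0.
  by rewrite integral_normal_pdf mule1 ltry.
apply: (@le_lt_trans _ _ (\int[leb]_x ((expR (c * x) * normal_pdf m s x)%:E +
    (expR (- c * x) * normal_pdf m s x)%:E))%E).
  apply: ge0_le_integral => //.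
  - by move=> x _; rewrite lee_fin mulr_ge0 ?expR_ge0 ?normal_pdf_ge0.
  - apply/measurable_EFinP; apply: measurable_funM; last exact: measurable_normal_pdf.
    apply: (measurableT_comp (@measurable_expR R)); apply: measurable_funM => //.
  - exact: (emeasurable_funD (me c) (me (- c))).
  - move=> x _; rewrite -EFinD lee_fin -mulrDl ler_wpM2r ?normal_pdf_ge0//.
    have [x0|x0] := leP 0 x.
      by rewrite ger0_norm// lerDl expR_ge0.
    by rewrite ltr0_norm// mulrN -mulNr lerDr expR_ge0.
rewrite ge0_integralD//; [|exact: me|exact: me].
by rewrite lte_add_pinfty.
Qed.

Variables (disp : measure_display) (Omega : measurableType disp).
Variable P : probability Omega R.

(** Both sides are cut into slices according to the integer part of |Y|.  On one
slice the exponential varies by a factor of at most e^c, so that the masses of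
the slices, which the law of [Y] prescribes, are enough for the comparison. *)
Lemma expR_integral_le_density (Y : Omega -> R) (g : R -> R) (c : R) :
  measurable_fun setT Y -> measurable_fun setT g -> (forall x, 0 <= g x) ->
  (forall A, measurable A -> P (Y @^-1` A) = (\int[leb]_(x in A) (g x)%:E)%E) ->
  0 <= c ->
  (\int[P]_w (expR (c * `|Y w|))%:E <=
   (expR c)%:E * \int[leb]_x (expR (c * `|x|) * g x)%:E)%E.
Proof.
move=> mY mg g0 law c0; pose B n : set R := [set x | Num.truncn `|x| = n].
have mn : measurable_fun [set: R] (fun x : R => `|x|) by exact: measurableT_comp.
have mB n : measurable (B n).
  rewrite (_ : B n = setT `&` (fun x : R => `|x|) @^-1` `[n%:R, n.+1%:R[).
    by apply: mn => //; exact: measurable_itv.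
  apply/seteqP; split => x /=; rewrite /B/= in_itv/=.
    by move=> <-; split => //; exact: truncn_itv.
  by move=> [_]; exact: truncn_def.
have BT : \bigcup_n B n = setT.
  by apply/seteqP; split => // x _; exists (Num.truncn `|x|).
have tB : trivIset setT B.
  exact: (@trivIset_preimage1 _ _ setT (fun x : R => Num.truncn `|x|)).
have mA n : measurable (Y @^-1` B n).
  by rewrite -[X in measurable X]setTI; exact: mY.
have mh : measurable_fun setT (fun x : R => expR (c * `|x|)).
  apply: (measurableT_comp (@measurable_expR R)); exact: measurable_funM.
have mhY : measurable_fun setT (fun w => (expR (c * `|Y w|))%:E).
  by apply/measurable_EFinP; exact: (measurableT_comp mh).
have mhg : measurable_fun [set: R] (fun x : R => (expR (c * `|x|) * g x)%:E).
  by apply/measurable_EFinP; exact: measurable_funM.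
have hg0 x : (0 <= (expR (c * `|x|) * g x)%:E)%E.
  by rewrite lee_fin mulr_ge0 ?expR_ge0.
rewrite -ge0_integralZl//.
have -> : [set: Omega] = \bigcup_n (Y @^-1` B n).
  by rewrite -preimage_bigcup BT preimage_setT.
have tA : trivIset setT (fun n => Y @^-1` B n) 
  by exact: (@trivIset_preimage1 _ _ setT (fun w => Num.truncn `|Y w|)).
rewrite (ge0_integral_bigcup _ mA (measurable_funTS mhY) _ tA); last first.
  by move=> w _; rewrite lee_fin expR_ge0.
rewrite -[X in (_ <= \int[_]_(x in X) _)%E]BT.
rewrite ge0_integral_bigcup//; last 2 first.
- by apply: measurable_funTS; apply: measurable_funeM; exact: mhg.
- by move=> x _; rewrite mule_ge0// lee_fin expR_ge0.
apply: lee_nneseries => [n _ _|n _].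
  by apply: integral_ge0 => w _; rewrite lee_fin expR_ge0.
apply: (@le_trans _ _ (\int[P]_(w in Y @^-1` B n) (cst (expR (c * n.+1%:R))%:E w))%E).
  apply: ge0_le_integral => //.
  - exact: measurable_funTS.
  - move=> w /= <-; rewrite lee_fin ler_expR ler_wpM2l// ltW//.
    exact: truncnS_gt.
rewrite integral_cst// [X in (_ * X <= _)%E](law _ (mB n)).
rewrite -ge0_integralZl ?lee_fin ?expR_ge0//; last 3 first.
  - exact: mB.
  - by apply/measurable_EFinP; exact: measurable_funTS.
  - by move=> x _; rewrite lee_fin.
apply: ge0_le_integral => //.
- exact: mB.
- by move=> x _; rewrite mule_ge0// lee_fin ?expR_ge0.
- by apply: measurable_funeM; apply/measurable_EFinP; exact: measurable_funTS.
- by apply: measurable_funTS; apply: measurable_funeM; exact: mhg.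
- move=> x /= <-; rewrite -!EFinM lee_fin mulrA -expRD ler_wpM2r// ler_expR.
  rewrite -natr1 mulrDr mulr1 addrC lerD2l ler_wpM2l//.
  by have /andP[] := truncn_itv (normr_ge0 x).
Qed.

Lemma gaussian_rv_expR (Y : Omega -> R) (c : R) : gaussian_rv P Y -> 0 <= c ->
  (\int[P]_w (expR (c * `|Y w|))%:E < +oo)%E.
Proof.
move=> [mY [m [s law]]] c0; have [s0|s0] := eqVneq s 0; last first.
  apply: le_lt_trans (expR_integral_le_density mY (measurable_normal_pdf m s)
    (normal_pdf_ge0 m s) _ c0) _.
    by move=> A mA; rewrite law// (negbTE s0).
  by rewrite lte_mul_pinfty ?lee_fin ?expR_ge0//; exact: integral_expR_normal_pdf.
have mh : measurable_fun setT (fun x : R => (expR (c * `|x|))%:E).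
  apply/measurable_EFinP; apply: (measurableT_comp (@measurable_expR R)).
  exact: measurable_funM.
have := @ge0_integral_pushforward _ _ _ _ _ Y mY P setT _ measurableT mh.
rewrite preimage_setT /comp => <-; last by move=> x _; rewrite lee_fin expR_ge0.
rewrite (@eq_measure_integral _ _ _ _ \d_m); last first.
  by move=> A mA _; rewrite /= /pushforward law// s0 eqxx.
by rewrite integral_dirac// diracT mul1e ltry.
Qed.

End gaussian.

(** * Path space *)

Section path_space_topology.
Variables (R : realType) (T : R) (n : nat).
Implicit Types x y : path_space T n.

Lemma ev_path_fun x (s : set_type [set` `[0, T]]) : ev x (\val s) = path_fun x s.
Proof.
have := valLK (0 : 'rV[R]_n) (path_fun x : set_type [set` `[0, T]] -> _).
by move=> /(congr1 (@^~ s)).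
Qed.

Lemma path_space_ext x y :
  (forall t, 0 <= t <= T -> ev x t = ev y t) -> x = y.
Proof.
move=> xy; apply/continuousEP => s.
rewrite -[LHS](ev_path_fun x) -[RHS](ev_path_fun y); apply: xy.
by have := set_valP s; rewrite /= in_itv.
Qed.

(** Convergence in path space can be checked coordinate by coordinate, on the
extension of the paths to real times. *)
Lemma cvg_path_space (U : Type) (F : set_system U) (y : U -> path_space T n) x :
  Filter F ->
  (forall e : R, 0 < e -> \forall u \near F, forall t j, 0 <= t <= T ->
    `|ev (y u) t ord0 j - ev x t ord0 j| <= e) ->
  y u @[u --> F] --> x.
Proof.
move=> FF yx; apply/cvg_ballP => e e0.
have e20 : 0 < e / 2 by rewrite divr_gt0.
apply: filterS (yx _ e20) => u yu; rewrite /ball/= /initial_ball => s.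
split => // i j; rewrite ord1 -!ev_path_fun /ball/= distrC.
apply: (@le_lt_trans _ _ (e / 2)); last by rewrite ltr_pdivrMr// ltr_pMr// ltr1n.
by apply: yu; have := set_valP s; rewrite /= in_itv.
Qed.

End path_space_topology.

Lemma cvg_sum (R : realType) (U : Type) (F : set_system U) (I : Type)
    (r : seq I) (f : I -> U -> R) (a : I -> R) : Filter F ->
  (forall i, f i x @[x --> F] --> a i) ->
  (\sum_(i <- r) f i x) @[x --> F] --> (\sum_(i <- r) a i).
Proof.
by move=> FF fa; apply: cvg_big => //; exact: add_continuous.
Qed.

(** * Piecewise linear paths *)

Section piecewise_linear_paths.
Variables (R : realType) (T : R) (d : nat).

Definition ramp (p q t : R) := (clamp p q t - p) / (q - p).

Lemma continuous_clamp (p q : R) : continuous (clamp p q).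
Proof.
move=> t; apply: continuous_min; first exact: cvg_cst.
by apply: continuous_max => //; exact: cvg_cst.
Qed.

Lemma ramp_itv (p q t : R) : p < q -> 0 <= ramp p q t <= 1.
Proof.
move=> pq; have /andP[h1 h2] := clamp_itv t (ltW pq).
rewrite /ramp divr_ge0 ?subr_ge0 ?(ltW pq)//=.
by rewrite ler_pdivrMr ?subr_gt0// mul1r lerD2r.
Qed.

(** The recursive interpolation as a sum of increments weighted by ramps: this
is the form in which it is linear in the increments. *)
Lemma interp_funE (u : R -> 'rV[R]_d) (a : R) (s : seq R) (t : R) :
  path <%R a s -> a <= t -> interp_fun u a s t =
  u a + \sum_(k < size s) ramp (nth 0 (a :: s) k) (nth 0 s k) t *:
    (u (nth 0 s k) - u (nth 0 (a :: s) k)).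
Proof.
have ramp0 (b : R) (s' : seq R) k : path <%R b s' -> t <= b -> (k < size s')%N ->
    ramp (nth 0 (b :: s') k) (nth 0 s' k) t = 0.
  elim: s' b k => // c s' IH b [|k] /=.
    move=> /andP[bc _] tb _; rewrite /ramp /clamp max_l// min_r ?(ltW bc)//.
    by rewrite subrr mul0r.
  move=> /andP[bc cs] tb ks; apply: IH => //.
  exact: le_trans tb (ltW bc).
elim: s a => [|b s IH] a /=; first by rewrite big_ord0 addr0.
move=> /andP[ab bs] at_; rewrite big_ord_recl/=.
case: leP => tb.
  rewrite big1 ?addr0; last by move=> k _; rewrite (ramp0 _ _ k bs tb (ltn_ord k)) scale0r.
  by rewrite /ramp /clamp max_r// min_r.
rewrite IH ?(ltW tb)//.
rewrite (_ : ramp a b t = 1) ?scale1r; last first.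
  rewrite /ramp /clamp max_r// min_l ?(ltW tb)// divff//.
  by rewrite subr_eq0 gt_eqF.
by rewrite addrA [u a + _]addrC subrK.
Qed.

Variable pi_ : partition_of T.
Local Notation m := (size pi_).
(** The list of a partition omits its initial point 0. *)
Definition node (k : nat) : R := nth 0 (0 :: (pi_ : seq R)) k.

Lemma node_lt i j : (i < j)%N -> (j <= m)%N -> node i < node j.
Proof.
move=> ij jm; have [ps _] := points_itv_partition pi_.
have := @sorted_ltn_nth _ <%R lt_trans 0 (0 :: (pi_ : seq R)).
by apply => //; rewrite inE/= ltnS// ltnW// (leq_trans ij).
Qed.

Lemma node_le i j : (i <= j)%N -> (j <= m)%N -> node i <= node j.
Proof.
rewrite leq_eqVlt => /predU1P[->//|ij] jm; exact/ltW/node_lt.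
Qed.

Lemma node_last : node m = T.
Proof.
have [_ /eqP l] := points_itv_partition pi_; rewrite -[RHS]l /node.
by case: (points pi_) => //= a s; rewrite -[last a s](nth_last 0 (a :: s)).
Qed.

Lemma node_itv (k : 'I_m) : 0 <= node k /\ node k <= node k.+1 /\ node k.+1 <= T.
Proof.
have km := ltn_ord k.
split; first exact: (@node_le 0%N) (ltnW km).
split; first exact: node_le.
by apply: le_trans (node_le km (leqnn _)) _; rewrite node_last.
Qed.

Definition increment (g : 'rV[R]_(m * d)) (k : 'I_m) (i : 'I_d) : R :=
  g ord0 (mxvec_index k i).

(** The piecewise linear path started at 0 whose increments over the partition
are prescribed. *)
Definition pl_fun (g : 'rV[R]_(m * d)) (t : R) : 'rV[R]_d :=
  \row_i \sum_(k < m) ramp (node k) (node k.+1) t * increment g k i.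

Lemma pl_fun_continuous g : continuous (pl_fun g).
Proof.
apply: continuous_rV => j.
rewrite (_ : (fun t => _) = fun t =>
    \sum_(k < m) ramp (node k) (node k.+1) t * increment g k j); last first.
  by apply/funext => t; rewrite mxE.
move=> t; apply: cvg_sum => k.
apply: cvgMr_tmp; apply: cvgMr_tmp; apply: cvgB; last exact: cvg_cst.
exact: continuous_clamp.
Qed.

Definition pl_path (g : 'rV[R]_(m * d)) : path_space T d :=
  mk_path (continuous_subspaceT (@pl_fun_continuous g)).

(** The parametrisation of all time-extended interpolated paths by the
finite-dimensional space of their increments. *)
Definition pl_hat (g : 'rV[R]_(m * d)) : path_space T d.+1 :=
  time_ext (pl_path g).

Lemma ev_time_ext (x : path_space T d) t j : 0 <= t <= T ->
  ev (time_ext x) t ord0 j =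
  if unlift ord0 j is Some i then ev x t ord0 i else t.
Proof. by move=> t0T; rewrite ev_mk_path// mxE. Qed.

Lemma ev_pl_hat g t j : 0 <= t <= T -> ev (pl_hat g) t ord0 j =
  if unlift ord0 j is Some i then
    \sum_(k < m) ramp (node k) (node k.+1) t * increment g k i else t.
Proof.
move=> t0T; rewrite ev_time_ext//; case: (unlift ord0 j) => // i.
by rewrite ev_mk_path// mxE.
Qed.

Definition increments (x : path_space T d) : 'rV[R]_(m * d) :=
  mxvec (\matrix_(k, i) (ev x (node k.+1) ord0 i - ev x (node k) ord0 i)).

Lemma increment_increments x k i : increment (increments x) k i =
  ev x (node k.+1) ord0 i - ev x (node k) ord0 i.
Proof. by rewrite /increment mxvecE mxE. Qed.

Lemma interp_pl_path (x : path_space T d) : ev x 0 = 0 ->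
  interp pi_ x = pl_path (increments x).
Proof.
move=> x0; apply: path_space_ext => t t0T; rewrite !ev_mk_path//.
have [t0 tT] := andP t0T; have [ps _] := points_itv_partition pi_.
rewrite interp_funE// x0 add0r; apply/rowP => i; rewrite summxE mxE.
by apply: eq_bigr => k _; rewrite increment_increments !mxE.
Qed.

Lemma pl_hat_piecewise_affine g j : 0 < T ->
  piecewise_affine T (fun t => ev (pl_hat g) t ord0 j).
Proof.
move=> T0; case: (unliftP ord0 j) => [i|] jE.
  exists (- \sum_(k < m) node k / (node k.+1 - node k) * increment g k i), m.
  exists (fun k => increment g k i / (node k.+1 - node k)).
  exists (fun k : 'I_m => node k), (fun k : 'I_m => node k.+1).
  split; first exact: node_itv.
  move=> t t0T; rewrite ev_pl_hat// jE liftK -sumrN -big_split/=.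
  by apply: eq_bigr => k _; rewrite /ramp; ring.
exists 0, 1%N, (cst 1), (cst 0), (cst T); split => [k|t t0T].
  by rewrite lexx (ltW T0).
rewrite ev_pl_hat// jE unlift_none big_ord1 mul1r add0r.
by case/andP: t0T => t0 tT; rewrite /clamp max_r// min_r.
Qed.

Lemma pl_hat_dist g g' t j : 0 <= t <= T ->
  `|ev (pl_hat g) t ord0 j - ev (pl_hat g') t ord0 j| <=
  \sum_k \sum_i `|increment g k i - increment g' k i|.
Proof.
move=> t0T; rewrite !ev_pl_hat//; case: (unlift ord0 j) => [i|]; last first.
  by rewrite subrr normr0; do 2 (apply: sumr_ge0 => ? _).
rewrite -sumrB (le_trans (ler_norm_sum _ _ _))// ler_sum// => k _.
rewrite -mulrBr normrM (bigD1 i)//=.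
have /andP[h0 h1] := ramp_itv t (node_lt (ltnSn k) (ltn_ord k)).
rewrite ger0_norm// -[leLHS]addr0 lerD ?sumr_ge0//.
by rewrite ler_piMl.
Qed.

Lemma increment_continuous k i : continuous (fun g => increment g k i).
Proof. exact: coord_continuous. Qed.

Lemma pl_hat_continuous : continuous pl_hat.
Proof.
move=> g; apply: (@cvg_path_space R T d.+1 _ (nbhs g) pl_hat) => e e0.
have D : (\sum_k \sum_i `|increment g' k i - increment g k i|) @[g' --> g] --> (0 : R).
  rewrite [X in _ --> X](_ : 0 =
      \sum_k \sum_i `|increment g k i - increment g k i| :> R); last first.
    by rewrite big1// => k _; rewrite big1// => i _; rewrite subrr normr0.
  apply: (@cvg_sum R _ (nbhs g)) => k; apply: (@cvg_sum R _ (nbhs g)) => i; apply: cvg_norm.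
  by apply: cvgB; [exact: increment_continuous|exact: cvg_cst].
have := @cvgr0_norm_le _ _ _ (nbhs g) (nbhs_filter g) _ D e e0; apply: filterS => g' g'e t j t0T.
by rewrite (le_trans (pl_hat_dist _ _ _ t0T))// (le_trans (ler_norm _)).
Qed.

End piecewise_linear_paths.

(** * Integrals of polynomials against a piecewise linear path *)

Section polynomials.
Variables (R : realType) (T : R).
Hypothesis T0 : 0 < T.
Implicit Types Q : {poly R}.

Lemma horner_bounded Q : exists2 C, 0 <= C &
  forall t, 0 <= t <= T -> `|Q.[t]| <= C.
Proof.
exists (\sum_(l < size Q) `|Q`_l| * T ^+ l).
  by apply: sumr_ge0 => l _; rewrite mulr_ge0// exprn_ge0// ltW.
move=> t /andP[t0 tT]; rewrite horner_coef (le_trans (ler_norm_sum _ _ _))//.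
apply: ler_sum => l _; rewrite normrM normrX ler_wpM2l// ger0_norm//.
by rewrite lerXn2r// nnegrE ltW.
Qed.

Lemma horner_lipschitz Q : lipschitz_upto T (horner Q).
Proof.
have [C C0 QC] := horner_bounded Q^`(); exists C => // u v u0 uv vT.
have [c /andP[uc cv] ->] := @horner_mean_value R T Q _ _ u0 uv vT.
rewrite normrM (@ger0_norm _ (v - u)) ?subr_ge0// ler_wpM2r ?subr_ge0//.
by rewrite QC// (le_trans u0 uc) (le_trans cv vT).
Qed.

End polynomials.

Section generators.
Variables (R : realType) (T : R) (d : nat) (pi_ : partition_of T).
Hypothesis T0 : 0 < T.
Local Notation m := (size pi_).
Local Notation node := (node pi_).
Local Notation G := 'rV[R]_(m * d).
Local Notation path g := (ev (pl_hat g)).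
Implicit Types (Q : {poly R}) (g : G) (i : 'I_d) (z : R * G).

Let pathA g j := pl_hat_piecewise_affine g j T0.

(** By uniqueness of primitives, since both sides solve dy = s^(l-1)/(l-1)! ds
from 0. *)
Lemma iterated_integral_time g l t : 0 <= t <= T ->
  iterated_integral (path g) (nseq l ord0) t = t ^+ l / l`!%:R.
Proof.
elim: l t => [t _|l IH t t0T]; first by rewrite expr0 fact0 divr1.
pose Q : {poly R} := (l.+1`!%:R)^-1 *: 'X^(l.+1).
have fact_neq0 k : k`!%:R != 0 :> R by rewrite pnatr_eq0 -lt0n fact_gt0.
have time_rep s : 0 <= s <= T -> path g s ord0 ord0 = 0 + \sum_(k < 1) 1 * clamp 0 T s.
  move=> s0T; rewrite ev_pl_hat// unlift_none big_ord1 mul1r add0r.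
  by case/andP: s0T => s0 sT; rewrite /clamp max_r// min_r.
have QP := @is_primitive_clamp R T d.+1 (path g) ord0 (horner Q) (horner Q^`()) 0 1
  (fun=> 1) (fun=> 0) (fun=> T) (fun=> conj (lexx 0) (conj (ltW T0) (lexx T)))
  time_rep (@horner_mean_value R T Q) (horner_lipschitz T0 _).
have IP := iterated_integral_consP T0 (pathA g) ord0 (nseq l ord0).
have QE s : 0 <= s <= T -> \sum_(k < 1) 1 * (Q.[clamp 0 T s] - Q.[0]) =
    s ^+ l.+1 / l.+1`!%:R.
  case/andP => s0 sT; rewrite big_ord1 mul1r /clamp max_r// min_r//.
  by rewrite !hornerZ !hornerXn expr0n/= mulr0 subr0 mulrC.
rewrite -QE//; have {}QP := eq_is_primitive _ (fun t _ => erefl) QP.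
apply: (is_primitive_unique IP (QP _ _) _ t0T) => [j s s0T|].
  case: (j == ord0) => //.
  rewrite IH// derivZ derivXn hornerZ hornerMn hornerXn factS natrM -mulr_natr.
  by field; rewrite fact_neq0 nat1r pnatr_eq0.
by rewrite (iterated_integral_cons0 T0 (pathA g)) QE ?lexx ?ltW// expr0n mul0r.
Qed.

(** This is int_0^t Q'(s) dx^i_s for (t, g) = z and x the path with increments
[g]: on the k-th interval dx^i has the constant density
g_(k,i) / (node (k+1) - node k). *)
Definition poly_integral Q i z : R := \sum_(k < m)
  increment z.2 k i / (node k.+1 - node k) *
    (Q.[clamp (node k) (node k.+1) z.1] - Q.[node k]).

Lemma poly_integral_primitive Q i g :
  is_primitive T (path g)
    (fun j => if j == lift ord0 i then horner Q^`() else cst 0)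
    (fun t => poly_integral Q i (t, g)).
Proof.
apply: (@is_primitive_clamp R T d.+1 (path g) (lift ord0 i) (horner Q)
    (horner Q^`()) (- \sum_(k < m) node k / (node k.+1 - node k) * increment g k i)
    m (fun k => increment g k i / (node k.+1 - node k))
    (fun k : 'I_m => node k) (fun k : 'I_m => node k.+1)).
- exact: node_itv.
- move=> t t0T; rewrite ev_pl_hat// liftK -sumrN -big_split/=.
  by apply: eq_bigr => k _; rewrite /ramp; ring.
- exact: horner_mean_value.
- exact: horner_lipschitz.
Qed.

Lemma poly_integral0 Q i g : poly_integral Q i (0, g) = 0.
Proof.
apply: big1 => k _; have [p0 [pq _]] := node_itv k.
by rewrite /clamp/= max_l// min_r// subrr mulr0.
Qed.

(** For Q = X^(l+1) the integrand is (l + 1)! times the l-fold iterated integral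
of time. *)
Lemma poly_integralXn l i t g : 0 <= t <= T ->
  poly_integral 'X^(l.+1) i (t, g) =
  l.+1`!%:R * iterated_integral (path g) (lift ord0 i :: nseq l ord0) t.
Proof.
move=> t0T; have IP := is_primitiveZ l.+1`!%:R
  (iterated_integral_consP T0 (pathA g) (lift ord0 i) (nseq l ord0)).
have fact_neq0 k : k`!%:R != 0 :> R by rewrite pnatr_eq0 -lt0n fact_gt0.
have {}IP := eq_is_primitive _ (fun t _ => erefl) IP.
apply: (is_primitive_unique (poly_integral_primitive _ i g) (IP _ _) _ t0T).
  move=> j s s0T; case: (j == _); last by rewrite mulr0.
  rewrite iterated_integral_time// derivXn hornerMn hornerXn factS natrM -mulr_natr.
  by field; exact: fact_neq0.
by rewrite poly_integral0 (iterated_integral_cons0 T0 (pathA g)) mulr0.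
Qed.

(** By linearity it is enough to consider monomials. *)
Lemma poly_integral_signature Q i :
  signature_functional T (fun g => path g) (poly_integral Q i).
Proof.
apply: (@eq_signature_functional _ _ _ _ _
    (fun z => \sum_(l < size Q) Q`_l * poly_integral 'X^l i z)).
  move=> t g _; under eq_bigr do rewrite mulr_sumr.
  rewrite exchange_big; apply: eq_bigr => k _/=.
  rewrite !(horner_coef Q) -sumrB mulr_sumr; apply: eq_bigr => l _.
  by rewrite !hornerXn; ring.
apply: signature_functional_sum => -[[|l] lQ]; apply: signature_functionalZ => /=.
  apply: eq_signature_functional (signature_functional_cst _ _ 0) => t g _.
  by rewrite /poly_integral big1// => k _; rewrite !hornerXn !expr0 subrr mulr0.
apply: (@eq_signature_functional _ _ _ _ _ (fun z => l.+1`!%:R *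
    iterated_integral (path z.2) (lift ord0 i :: nseq l ord0) z.1)).
  by move=> t g t0T; rewrite poly_integralXn.
by apply: signature_functionalZ; exact: signature_functional_word.
Qed.

Definition generator (c b : R) (q : 'I_d -> {poly R}) z : R :=
  c + b * z.1 + \sum_i poly_integral (q i) i z.

Definition generators : set (R * G -> R) :=
  [set l | exists c b q, l = generator c b q].

Lemma poly_integralD Q Q' i z :
  poly_integral (Q + Q') i z = poly_integral Q i z + poly_integral Q' i z.
Proof.
by rewrite -big_split/=; apply: eq_bigr => k _; rewrite !hornerD; ring.
Qed.

Lemma poly_integralZ a Q i z :
  poly_integral (a *: Q) i z = a * poly_integral Q i z.
Proof.
by rewrite mulr_sumr; apply: eq_bigr => k _; rewrite !hornerZ; ring.
Qed.

Lemma poly_integral_zero i z : poly_integral 0 i z = 0.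
Proof. by apply: big1 => k _; rewrite !horner0 subrr mulr0. Qed.

Lemma generators_cst c : generators (cst c).
Proof.
exists c, 0, (fun=> 0); apply/funext => z; rewrite /generator mul0r addr0.
by rewrite big1 ?addr0// => i _; exact: poly_integral_zero.
Qed.

Lemma generatorsD a b : generators a -> generators b ->
  generators (fun z => a z + b z).
Proof.
move=> [c [e [Q ->]]] [c' [e' [Q' ->]]].
exists (c + c'), (e + e'), (fun i => Q i + Q' i); apply/funext => z.
rewrite /generator; under [in RHS]eq_bigr do rewrite poly_integralD.
by rewrite big_split/=; ring.
Qed.

Lemma generatorsZ r a : generators a -> generators (fun z => r * a z).
Proof.
move=> [c [e [Q ->]]]; exists (r * c), (r * e), (fun i => r *: Q i).
apply/funext => z; rewrite /generator.
under [in RHS]eq_bigr do rewrite poly_integralZ.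
by rewrite -mulr_sumr; ring.
Qed.

Lemma generators_signature a : generators a ->
  signature_functional T (fun g => path g) a.
Proof.
move=> [c [e [Q ->]]]; apply: signature_functionalD; last first.
  by apply: signature_functional_sum => i; exact: poly_integral_signature.
apply: signature_functionalD; first exact: signature_functional_cst.
apply: signature_functionalZ.
apply: eq_signature_functional (signature_functional_word _ _ [:: ord0]).
by move=> t g t0T; rewrite (iterated_integral_time _ 1)// expr1 -[RHS]divr1.
Qed.

Lemma generators_continuous a : generators a -> continuous a.
Proof.
move=> [c [e [Q ->]]] z; apply: cvgD.
  apply: cvgD; first exact: cvg_cst.
  by apply: cvgM; [exact: cvg_cst|exact: cvg_fst].
apply: (@cvg_sum R _ (nbhs z)) => i; apply: (@cvg_sum R _ (nbhs z)) => k.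
apply: cvgM.
  apply: cvgM; last exact: cvg_cst.
  apply: (@cvg_comp _ _ _ snd (fun g => increment g k i)); first exact: cvg_snd.
  exact: increment_continuous.
apply: cvgB; last exact: cvg_cst.
apply: (@cvg_comp _ _ _ fst (fun t => (Q i).[clamp (node k) (node k.+1) t])).
  exact: cvg_fst.
apply: (@cvg_comp _ _ _ (clamp (node k) (node k.+1)) (horner (Q i))).
  exact: continuous_clamp.
apply: differentiable_continuous; apply/derivable1_diffP.
exact: derivable_horner.
Qed.

Lemma generators_bounded a : generators a -> exists2 C, 0 <= C &
  forall t g, 0 <= t <= T ->
    `|a (t, g)| <= C * (1 + \sum_k \sum_i `|increment g k i|).
Proof.
move=> [c [e [Q ->]]].
have [B HB] : {B : 'I_d -> R & forall i, 0 <= B i /\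
    forall t, 0 <= t <= T -> `|(Q i).[t]| <= B i}.
  apply: (@choice _ _ (fun i b => 0 <= b /\
    forall t, 0 <= t <= T -> `|(Q i).[t]| <= b)) => i.
  by have [b b0 hb] := horner_bounded T0 (Q i); exists b.
pose D := \sum_i \sum_(k < m) 2 * B i / (node k.+1 - node k).
have gap k : (k < m)%N -> 0 < node k.+1 - node k.
  by move=> km; rewrite subr_gt0 node_lt.
have Dle i k : 2 * B i / (node (k : 'I_m).+1 - node k) <= D.
  rewrite /D (bigD1 i)//= (bigD1 k)//= -addrA lerDl addr_ge0//.
    apply: sumr_ge0 => k' _; rewrite divr_ge0 ?(ltW (gap _ _))// mulr_ge0//.
    exact: (HB i).1.
  apply: sumr_ge0 => i' _; apply: sumr_ge0 => k' _.
  by rewrite divr_ge0 ?(ltW (gap _ _))// mulr_ge0//; exact: (HB i').1.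
have D0 : 0 <= D.
  apply: sumr_ge0 => i' _; apply: sumr_ge0 => k' _.
  by rewrite divr_ge0 ?(ltW (gap _ _))// mulr_ge0//; exact: (HB i').1.
have C0 : 0 <= `|c| + `|e| * T by rewrite addr_ge0// mulr_ge0// ltW.
exists (`|c| + `|e| * T + D); first by rewrite addr_ge0.
move=> t g t0T; have [t0 tT] := andP t0T.
set S := \sum_k _; have S0 : 0 <= S by do 2 (apply: sumr_ge0 => ? _).
apply: (@le_trans _ _ (`|c| + `|e| * T + D * S)); last first.
  rewrite mulrDl mulrDr mulr1; set X := `|c| + _ in C0 *; nra.
rewrite /generator (le_trans (ler_normD _ _))// lerD//.
  rewrite (le_trans (ler_normD _ _))// lerD// normrM ler_wpM2l//.
  by rewrite ger0_norm.
rewrite (le_trans (ler_norm_sum _ _ _))// /S exchange_big mulr_sumr/=.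
apply: ler_sum => i _; rewrite (le_trans (ler_norm_sum _ _ _))// mulr_sumr.
apply: ler_sum => k _; have km := gap _ (ltn_ord k).
have [p0 [pq qT]] := node_itv k.
have /andP[h1 h2] := clamp_itv t pq.
set v := _.[_] - _.[_]; have vB : `|v| <= 2 * B i.
  rewrite (le_trans (ler_normB _ _))// mulr_natl mulr2n lerD//; apply: (HB i).2.
    by rewrite (le_trans p0 h1) (le_trans h2 qT).
  by rewrite p0 (le_trans pq qT).
rewrite mulrC mulrA 2!normrM normfV (gtr0_norm km) mulrAC ler_wpM2r//.
apply: le_trans (Dle i k); rewrite ler_wpM2r// invr_ge0; exact: ltW.
Qed.

(** The time is itself a generator.  For the path, suppose that some increments
over intervals begun before t differ, and let k be the last such interval.  The
polynomial Q = prod_(j <= k) (X - node j) vanishes at both ends of every earlier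
interval and at the left end of the k-th, so that int_0^t Q' dx depends only on
the k-th increment among those that differ, with the nonzero coefficient
Q(min(t, node (k+1))) / (node (k+1) - node k). *)
Lemma generators_separate t g t' g' : 0 <= t <= T ->
  (forall a, generators a -> a (t, g) = a (t', g')) ->
  t = t' /\ forall s, 0 <= s <= t -> path g s = path g' s.
Proof.
move=> t0T sep; have [t0 tT] := andP t0T.
have tt : t = t'.
  have := sep (generator 0 1 (fun=> 0)); rewrite /generator !add0r !mul1r/=.
  rewrite !big1 ?addr0; [|by move=> i _; exact: poly_integral_zero..].
  by apply; exists 0, 1, (fun=> 0).
split => // s /andP[s0 st]; rewrite -tt in sep.
have sT := le_trans st tT.
have gen Q i : poly_integral Q i (t, g) = poly_integral Q i (t, g').
  pose Qi j := if j == i then Q else 0.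
  have := sep (generator 0 0 Qi); rewrite /generator !mul0r !add0r.
  have E z : \sum_j poly_integral (Qi j) j z = poly_integral Q i z.
    rewrite (bigD1 i)//= /Qi eqxx big1 ?addr0// => j /negPf ->.
    exact: poly_integral_zero.
  by rewrite !E; apply; exists 0, 0, Qi.
pose delta i (k : 'I_m) := increment g k i - increment g' k i.
have delta0 i (k : 'I_m) : node k < t -> delta i k = 0.
  move=> kt; apply/eqP; apply: contraT => dk.
  pose bad (k : 'I_m) := (node k < t) && (delta i k != 0).
  have badk : bad k by rewrite /bad kt.
  case: (@arg_maxnP _ k bad (fun k => k : nat) badk) => {kt dk badk k} k.
  move=> /andP[kt dk] kmax.
  pose Q : {poly R} := \prod_(j < k.+1) ('X - (node j)%:P).
  have Q0 j : (j <= k)%N -> Q.[node j] = 0.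
    move=> jk; rewrite /Q horner_prod.
    rewrite (bigD1 (Ordinal (jk : (j < k.+1)%N)))//= hornerXsubC subrr mul0r//.
  have km := ltn_ord k; pose b := clamp (node k) (node k.+1) t.
  have kb : node k < b.
    rewrite /b /clamp lt_min node_lt//= lt_max kt orbT//.
  have Qb : Q.[b] != 0.
    rewrite /Q horner_prod; apply/prodf_neq0 => j _.
    rewrite hornerXsubC subr_eq0 gt_eqF// (le_lt_trans _ kb)// node_le//.
      by rewrite -ltnS.
    exact: ltnW.
  have := gen Q i => /eqP; rewrite -subr_eq0 -sumrB (bigD1 k)//= big1 ?addr0.
    rewrite -mulrBl -mulrBl -/(delta i k) Q0// subr0 -/b !mulf_eq0.
    rewrite (negbTE dk) (negbTE Qb) orbF invr_eq0 subr_eq0 gt_eqF//.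
    exact: node_lt.
  move=> j jk; rewrite -mulrBl -mulrBl -/(delta i j).
  have [jk'|kj|/val_inj kj] := ltngtP j k; last by rewrite kj eqxx in jk.
    have -> : clamp (node j) (node j.+1) t = node j.+1.
      rewrite /clamp min_l// le_max; apply/orP; right.
      by rewrite (le_trans _ (ltW kt))// node_le// ltnW.
    by rewrite !Q0 ?subrr ?mulr0// ltnW.
  have [jt|jt] := ltP (node j) t.
    have [->|dj] := eqVneq (delta i j) 0; first by rewrite !mul0r.
    have := kmax j; rewrite /bad jt dj => /(_ isT).
    by rewrite /= leqNgt kj.
  rewrite /clamp max_l// min_r ?subrr ?mulr0// node_le//.
apply/rowP => j; rewrite !ev_pl_hat ?s0//.
case: (unlift ord0 j) => // i; apply: eq_bigr => k _.
have [kt|tk] := ltP (node k) t.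
  by congr (_ * _); apply/eqP; rewrite -subr_eq0; apply/eqP/delta0.
have [p0 [pq _]] := node_itv k.
rewrite /ramp /clamp max_l ?(le_trans st)// min_r// subrr !mul0r//.
Qed.

End generators.

(** * Convergence of the interpolations *)

Section interpolation_convergence.
Variables (R : realType) (T : R) (d : nat).

(** One of the two points is quantified over the compact set on which the
induction runs, the other one over all of [0, T]. *)
Lemma path_uniformly_continuous (x : path_space T d) (e : R) : 0 < e ->
  exists2 delta : R, 0 < delta & forall u v j, 0 <= u <= T -> 0 <= v <= T ->
    `|u - v| < delta -> `|ev x u ord0 j - ev x v ord0 j| <= e.
Proof.
move=> e0; pose Q (V : set R) := exists2 delta : R, 0 < delta &
  forall u v j, V u -> 0 <= v <= T ->
    `|u - v| < delta -> `|ev x u ord0 j - ev x v ord0 j| <= e.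
suff [delta d0 H] : Q [set` `[0, T]].
  by exists delta => // u v j u0T; apply: H; rewrite /= in_itv.
apply: compact_induction; first exact: segment_compact.
- by exists 1.
- by move=> A B AB [a a0 HB]; exists a => // u v j /AB; exact: HB.
- move=> A B [a a0 HA] [b b0 HB]; exists (Num.min a b); first by rewrite lt_min a0.
  by move=> u v j [/HA h|/HB h] v0T; rewrite lt_min => /andP[ua ub]; exact: h.
move=> y y0T; have e20 : 0 < e / 2 by rewrite divr_gt0.
have /subspace_continuousP/(_ y y0T)/cvg_ballP/(_ _ e20) := @ev_continuous _ _ _ x.
move=> /nbhs_ballP[r /= r0 Hr].
have {}Hr z j : 0 <= z <= T -> `|y - z| < r -> `|ev x y ord0 j - ev x z ord0 j| < e / 2.
  move=> z0T yz; have [] := Hr z yz; first by rewrite /= in_itv.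
  by move=> _; apply.
have r20 : 0 < r / 2 by rewrite divr_gt0.
exists (ball y (r / 2)); first exact: nbhsx_ballx.
exists (r / 2) => // u v j [yu u0T] v0T uv; rewrite /= in_itv/= in u0T.
rewrite /ball/= in yu.
have h1 : `|ev x y ord0 j - ev x u ord0 j| < e / 2.
  by apply: Hr => //; rewrite (lt_trans yu)// ltr_pdivrMr// ltr_pMr// ltr1n.
have h2 : `|ev x y ord0 j - ev x v ord0 j| < e / 2.
  apply: Hr => //; rewrite (le_lt_trans (ler_distD u _ _))// [r]splitr.
  exact: ltrD.
rewrite (le_trans (ler_distD (ev x y ord0 j) _ _))// [e]splitr.
by rewrite lerD// ltW// distrC.
Qed.

(** An interpolated value lies between values at two nodes that are closer than
[delta] to t: one [e] for the left node, one for the increment. *)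
Lemma interp_fun_dist (x : R -> 'rV[R]_d) (a : R) (s : seq R) (j : 'I_d)
    (delta e t : R) : path <%R a s -> a <= t -> t <= last a s ->
  mesh a s < delta ->
  (forall u v, a <= u <= last a s -> a <= v <= last a s -> `|u - v| < delta ->
    `|x u ord0 j - x v ord0 j| <= e) ->
  `|interp_fun x a s t ord0 j - x t ord0 j| <= e + e.
Proof.
elim: s a => [|b s IH] a /=.
  move=> _ at_ ta ms H; have -> : t = a by apply/eqP; rewrite eq_le ta.
  rewrite subrr normr0; have := H a a; rewrite !lexx subrr normr0.
  have d0 : 0 < delta by rewrite (le_lt_trans _ ms)// /mesh big_nil.
  by move=> /(_ isT isT d0) h; rewrite addr_ge0// (le_trans _ h).
move=> /andP[ab bs] at_ tl.
rewrite (_ : mesh a (b :: s) = Num.max (b - a) (mesh b s)); last first.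
  by rewrite /mesh big_cons.
rewrite gt_max => /andP[ba ms] H.
have bl : b <= last b s.
  by apply: (@itv_partition_le _ _ _ _ s); split.
case: (leP t b) => tb; last first.
  apply: IH => //; first exact: ltW.
  by move=> u v /andP[bu ul] /andP[bv vl]; apply: H;
    rewrite (le_trans (ltW ab))//.
rewrite !mxE; set th := (t - a) / (b - a).
have th01 : 0 <= th <= 1.
  rewrite /th divr_ge0 ?subr_ge0 ?(ltW ab)//=.
  by rewrite ler_pdivrMr ?subr_gt0// mul1r lerD2r.
have [th0 th1] := andP th01.
rewrite addrAC (le_trans (ler_normD _ _))// lerD//.
  apply: H; rewrite ?lexx ?at_ ?tl ?(le_trans (ltW ab) bl)//.
  by rewrite distrC ger0_norm ?subr_ge0//; lra.
rewrite normrM (ger0_norm th0) (@le_trans _ _ (1 * `|x b ord0 j - x a ord0 j|))//.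
  by rewrite ler_wpM2r.
rewrite mul1r; apply: H; rewrite ?lexx ?(ltW ab) ?bl ?(le_trans (ltW ab) bl)//.
by rewrite gtr0_norm// subr_gt0.
Qed.

Lemma interp_cvg (pi_ : nat -> partition_of T) (x : path_space T d) :
  mesh 0 (pi_ n) @[n --> \oo] --> (0 : R) ->
  time_ext (interp (pi_ n) x) @[n --> \oo] --> time_ext x.
Proof.
move=> mesh0; apply: cvg_path_space => e e0.
have e20 : 0 < e / 2 by rewrite divr_gt0.
have [delta d0 xu] := path_uniformly_continuous x e20.
have := @cvgr0_norm_lt _ _ _ _ _ _ mesh0 _ d0; move=> /(_ _); apply: filterS => n mn t j t0T.
rewrite !ev_time_ext//; case: (unlift ord0 j) => [i|]; last first.
  by rewrite subrr normr0 ltW.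
rewrite ev_mk_path//; have [t0 tT] := andP t0T.
have [ps /eqP ls] := points_itv_partition (pi_ n).
rewrite [e]splitr; apply: (@interp_fun_dist _ _ _ _ delta) => //.
- by rewrite ls.
- by rewrite (le_lt_trans (ler_norm _)).
- by rewrite ls => u v; exact: xu.
Qed.

End interpolation_convergence.

Lemma continuous_seq (U V : topologicalType) (h : U -> V) (u : nat -> U) x :
  continuous h -> u n @[n --> \oo] --> x -> h (u n) @[n --> \oo] --> h x.
Proof. by move=> hc ux B /(hc x)/ux. Qed.

Lemma within_continuous_seq (U V : topologicalType) (A : set U) (h : U -> V)
    (u : nat -> U) x : {within A, continuous h} ->
  A x -> (forall n, A (u n)) -> u n @[n --> \oo] --> x ->
  h (u n) @[n --> \oo] --> h x.
Proof.
move=> /subspace_continuousP hc Ax Au ux B hB.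
have H : \forall n \near \oo, A (u n) -> B (h (u n)) := ux _ (hc x Ax B hB).
by apply: filterS H => n; apply.
Qed.

Lemma within_composition_cvg (U U' V : topologicalType) (A : set U)
    (A' : set U') (h : U -> V) (k : U' -> U) x : {within A, continuous h} ->
  continuous k -> (forall z, A' z -> A (k z)) -> A' x ->
  h (k z) @[z --> within A' (nbhs x)] --> h (k x).
Proof.
move=> /subspace_continuousP hc kc kA Ax B hB.
have H : \forall z \near x, A (k z) -> B (h (k z)) :=
  kc x _ (hc (k x) (kA x Ax) B hB).
by apply: filterS H => z zB A'z; exact: zB (kA z A'z).
Qed.

(** * Exponential moments of the increments *)

Section exponential_moments.
Variables (R : realType) (disp : measure_display) (Omega : measurableType disp).
Variable P : probability Omega R.
Implicit Types Y Z : Omega -> R.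

Definition exp_moments Y := measurable_fun setT Y /\ (forall w, 0 <= Y w) /\
  forall c : R, 0 <= c -> (\int[P]_w (expR (c * Y w))%:E < +oo)%E.

Lemma exp_moments_measurable Y c : measurable_fun setT Y ->
  measurable_fun setT (fun w => (expR (c * Y w))%:E).
Proof.
move=> mY; apply/measurable_EFinP; apply: (measurableT_comp (@measurable_expR R)).
by apply: measurable_funM => //; exact: measurable_cst.
Qed.

(** exp (c (y + z)) is at most exp (2 c y) + exp (2 c z), according to which of
[y] and [z] is larger. *)
Lemma exp_momentsD Y Z : exp_moments Y -> exp_moments Z ->
  exp_moments (fun w => Y w + Z w).
Proof.
move=> [mY [Y0 eY]] [mZ [Z0 eZ]]; split; first exact: measurable_funD.
split=> [w|c c0]; first by rewrite addr_ge0.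
have c20 : 0 <= 2 * c by rewrite mulr_ge0.
have mY2 := exp_moments_measurable (2 * c) mY.
have mZ2 := exp_moments_measurable (2 * c) mZ.
apply: (@le_lt_trans _ _ (\int[P]_w ((expR (2 * c * Y w))%:E +
    (expR (2 * c * Z w))%:E))%E).
  apply: ge0_le_integral => //.
  - by apply: exp_moments_measurable; exact: measurable_funD.
  - exact: emeasurable_funD.
  move=> w _; rewrite -EFinD lee_fin.
  have [YZ|/ltW ZY] := leP (Y w) (Z w).
    rewrite (@le_trans _ _ (expR (2 * c * Z w)))// ?lerDr ?expR_ge0//.
    rewrite ler_expR -mulrA mulrCA ler_wpM2l//; lra.
  rewrite (@le_trans _ _ (expR (2 * c * Y w)))// ?lerDl ?expR_ge0//.
  rewrite ler_expR -mulrA mulrCA ler_wpM2l//; lra.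
have ge (c' : R) (W : Omega -> R) w : setT w -> (0 <= (expR (c' * W w))%:E)%E.
  by move=> _; rewrite lee_fin expR_ge0.
rewrite (ge0_integralD _ measurableT (ge _ Y) mY2 (ge _ Z) mZ2).
by apply: lte_add_pinfty; [exact: eY|exact: eZ].
Qed.

Lemma exp_moments_cst (r : R) : 0 <= r -> exp_moments (cst r).
Proof.
move=> r0; split; first exact: measurable_cst.
split => // c c0.
have -> : (fun w => (expR (c * cst r w))%:E) = cst (expR (c * r))%:E :> (Omega -> \bar R) by [].
rewrite integral_cst//.
rewrite (@le_lt_trans _ _ (expR (c * r))%:E) ?ltry// -[leRHS]mule1.
by rewrite lee_wpmul2l ?probability_le1// lee_fin expR_ge0.
Qed.

Lemma exp_moments_sum (I : Type) (s : seq I) (Y : I -> Omega -> R) :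
  (forall i, exp_moments (Y i)) -> exp_moments (fun w => \sum_(i <- s) Y i w).
Proof.
move=> eY; elim: s => [|i s IH].
  rewrite (_ : (fun w => _) = cst 0); first exact: exp_moments_cst.
  by apply/funext => w; rewrite big_nil.
rewrite (_ : (fun w => _) = fun w => Y i w + \sum_(i <- s) Y i w).
  exact: exp_momentsD.
by apply/funext => w; rewrite big_cons.
Qed.

Lemma gaussian_exp_moments Y : gaussian_rv P Y -> exp_moments (fun w => `|Y w|).
Proof.
move=> gY; split; first exact: measurableT_comp gY.1.
by split => // c; exact: gaussian_rv_expR.
Qed.

Variables (T : R) (d : nat) (X : Omega -> path_space T d) (pi_ : partition_of T).
Hypothesis gX : gaussian_process P X.

Lemma gaussian_increment (k : 'I_(size pi_)) (i : 'I_d) :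
  gaussian_rv P (fun w => increment (increments pi_ (X w)) k i).
Proof.
have [p0 [pq qT]] := node_itv k.
have := @gX 2 (fun l => if l == ord0 then 1 else -1) (fun=> i)
  (fun l => if l == ord0 then node pi_ k.+1 else node pi_ k).
rewrite (_ : (fun w => \sum_(l < 2) _) =
  (fun w => increment (increments pi_ (X w)) k i)); last first.
  apply/funext => w; rewrite increment_increments big_ord_recl big_ord1 /=.
  by rewrite mul1r mulN1r.
apply=> l; case: ifP => _; first by rewrite qT (le_trans p0).
by rewrite p0 (le_trans pq).
Qed.

Lemma increments_exp_moments : exp_moments (fun w =>
  \sum_k \sum_i `|increment (increments pi_ (X w)) k i|).
Proof.
apply: exp_moments_sum => k; apply: exp_moments_sum => i.
exact/gaussian_exp_moments/gaussian_increment.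
Qed.

End exponential_moments.

(** * Uniform integrability and truncation *)

Section uniform_integrability.
Variables (R : realType) (disp : measure_display) (S : measurableType disp).
Variables (mu : {measure set S -> \bar R}) (D : set S) (p : R).
Hypothesis p1 : 1 <= p.
Hypothesis mD : measurable D.

(** Uniform integrability of |h_n|^p in the form used by [vitali]. *)
Lemma uniformly_integrable_clamp (h : nat -> S -> R) :
  (forall n, measurable_fun D (h n)) ->
  uniformly_integrable mu (fun n z => `|((h n) \_ D) z| `^ p) ->
  forall e : R, 0 < e -> exists2 B : R, 0 <= B & forall n,
    (lp_dist mu D p (h n) (fun z => clamp (- B) B (h n z)) <= e%:E)%E.
Proof.
move=> mh ui e e0; have p0 : 0 < p by rewrite (lt_le_trans _ p1).
have e0' : (0 < e%:E)%E by rewrite lte_fin.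
have := ui _ (open_ereal_lt' e0'); rewrite /= nbhs_simpl/= => ui_e.
have [K [K0 HK]] : exists K : R, 0 < K /\ (ereal_sup
    [set (\int[mu]_(z in [set z | (K <= `|(`|((h n) \_ D) z| `^ p)|)%R])
       `|(`|((h n) \_ D) z| `^ p)|%R%:E)%E | n in [set: nat]] < e%:E)%E.
  near (pinfty_nbhs R) => K; exists K.
  by split; [near: K; exact: nbhs_pinfty_gt|near: K; exact: ui_e].
exists (K `^ p^-1) => [|n]; first exact: powR_ge0.
apply: le_trans (lp_dist_clamp_le mu p1 mD (mh n) K0 erefl) _.
apply: le_trans (ltW HK); apply: ereal_sup_ubound; exists n => //.
have hE z : `|(`|(h n \_ D) z| `^ p)| = if z \in D then `|h n z| `^ p else 0.
  rewrite (@ger0_norm _ (_ `^ p)) ?powR_ge0// /patch; case: ifP => // _.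
  by rewrite normr0 powR0// gt_eqF.
under eq_set do rewrite hE; under eq_integral do rewrite hE.
have -> : [set z | K <= if z \in D then `|h n z| `^ p else 0] =
    D `&` [set z | K <= `|h n z| `^ p].
  apply/seteqP; split => z /=; last by move=> [Dz]; rewrite mem_set.
  by case: ifPn => [/set_mem //|_]; rewrite leNgt K0.
by apply: eq_integral => z /set_mem[Dz _]; rewrite mem_set.
Unshelve. all: by end_near.
Qed.

(** The extension by 0 outside [D] is unfolded into statements on [D]. *)
Lemma Lfun_restrict (h : S -> R) : (h \_ D) \in Lfun mu p%:E ->
  measurable_fun D h /\ (\int[mu]_(z in D) (`|h z| `^ p)%:E < +oo)%E.
Proof.
move=> /andP[/set_mem mh /set_mem fh]; split.
  have /(measurable_restrict h mD measurableT) : measurable_fun setT (h \_ D) by exact: mh.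
  by rewrite setTI.
have p0 : p != 0 by rewrite gt_eqF// (lt_le_trans _ p1).
have <- : ('N[mu]_p%:E[EFin \o (h \_ D)] `^ p =
    \int[mu]_(z in D) (`|h z| `^ p)%:E)%E.
  rewrite powR_Lnorm// [RHS]integral_mkcond; apply: eq_integral => z _ /=.
  rewrite /patch; case: ifP => // _.
  by transitivity ((`|0 : R| `^ p)%:E) => //; rewrite normr0 powR0.
by apply: poweR_lty.
Qed.

End uniform_integrability.

(** * Approximation along one partition *)

Section signature_density.
Variables (R : realType) (disp : measure_display) (S : measurableType disp).
Variables (mu : {measure set S -> \bar R}) (D : set S) (p : R).
Hypothesis p1 : 1 <= p.
Hypothesis mD : measurable D.
Hypothesis muD : (mu D < +oo)%E.
Variables (T : R) (d : nat) (pi_ : partition_of T).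
Hypothesis T0 : 0 < T.
Local Notation G := 'rV[R]_(size pi_ * d).
Variables (tau : S -> R) (W : S -> G) (TK : set R) (F : R * G -> R).
Hypothesis TKc : compact TK.
Hypothesis TK0T : TK `<=` [set` `[0, T]].
Hypothesis tauTK : forall z, D z -> TK (tau z).
Hypothesis mtau : measurable_fun D tau.
Hypothesis mW : forall k i, measurable_fun D (fun z => increment (W z) k i).
Hypothesis eW : forall c : R, 0 <= c -> (\int[mu]_(z in D)
  (expR (c * (1 + \sum_k \sum_i `|increment (W z) k i|)))%:E < +oo)%E.
Hypothesis cF : forall x, TK x.1 ->
  F z @[z --> within (TK `*` setT) (nbhs x)] --> F x.
Hypothesis Fsep : forall t g g', TK t ->
  (forall s, 0 <= s <= t -> ev (pl_hat g) s = ev (pl_hat g') s) ->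
  F (t, g) = F (t, g').
Hypothesis mF : measurable_fun D (fun z => F (tau z, W z)).
Hypothesis iF : (\int[mu]_(z in D) (`|F (tau z, W z)| `^ p)%:E < +oo)%E.

Let Theta z := (tau z, W z).
Let A : set (R * G -> R) := [set a |
  signature_functional T (fun g => ev (pl_hat g)) a /\
  measurable_fun D (a \o Theta)].
Let K N : set (R * G) := TK `*` [set g : G | forall j, `|g ord0 j| <= N%:R].

Let tau_itv z : D z -> 0 <= tau z <= T.
Proof. by move=> /tauTK /TK0T; rewrite /= in_itv. Qed.

Let generators_measurable a : generators a -> measurable_fun D (a \o Theta).
Proof.
move=> [c [e [Q ->]]]; apply: measurable_funD.
  apply: measurable_funD; first exact: measurable_cst.
  by apply: measurable_funM => //; exact: measurable_cst.
apply: measurable_sum => i; apply: measurable_sum => k.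
apply: measurable_funM.
  by apply: measurable_funM; [exact: mW|exact: measurable_cst].
apply: measurable_funB; last exact: measurable_cst.
have mQ : measurable_fun setT (horner (Q i)).
  apply: continuous_measurable_fun => t.
  apply: differentiable_continuous; apply/derivable1_diffP.
  exact: derivable_horner.
by apply: (measurableT_comp mQ); exact: measurable_clamp.
Qed.

Let compact_K N : compact (K N).
Proof.
have cG : compact [set g : G | forall j, g ord0 j \in `[- N%:R, N%:R]].
  apply: (@rV_compact _ _ (fun=> `[- (N%:R : R), N%:R]%classic)) => _.
  exact: segment_compact.
apply: compact_setX => //; move: cG; congr compact.
by apply/seteqP; split => g /= h j; have := h j; rewrite in_itv/= ler_norml.
Qed.

(** The abstract density result applied to the generators and to the algebra of
measurable signature functionals.  The map [tau] is the running time, or the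
constant T for a terminal functional; it takes values in a compact set [TK] of
times. *)
Lemma signature_density (e : R) : 0 < e ->
  exists N l, measurable_fun D (fun z => linear_functional N l
      (signature (pl_hat (W z)) (tau z))) /\
    (lp_dist mu D p (fun z => F (tau z, W z)) (fun z => linear_functional N l
      (signature (pl_hat (W z)) (tau z))) < e%:E)%E.
Proof.
move=> e0.
have [||||||||||||||||a [sa ma] Fa] := @lp_density _ _ _ mu D p p1 mD muD
  (R * G)%type Theta (@generators R T d pi_) A _ _ _ _ _ _ _ _ _
  K (fun z => \sum_k \sum_i `|increment (W z) k i|) F _ _ _ _ _ _ _ e e0.
- exact: generators_cst.
- exact: generatorsD.
- exact: generatorsZ.
- exact: generators_continuous.
- move=> a ga; have [C C0 aC] := generators_bounded T0 ga.
  apply: le_lt_trans (eW C0); apply: ge0_le_integral => //.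
  + apply/measurable_EFinP; apply: (measurableT_comp (@measurable_expR R)).
    by apply: measurableT_comp => //; exact: generators_measurable.
  + apply/measurable_EFinP; apply: (measurableT_comp (@measurable_expR R)).
    apply: measurable_funM; first exact: measurable_cst.
    apply: measurable_funD; first exact: measurable_cst.
    apply: measurable_sum => k; apply: measurable_sum => i.
    exact: measurableT_comp.
  + by move=> z Dz; rewrite lee_fin ler_expR; exact: aC (tau_itv Dz).
- by move=> a ga; split; [exact: generators_signature|exact: generators_measurable].
- move=> a b [sa ma] [sb mb]; split; first exact: signature_functionalD.
  exact: measurable_funD.
- move=> a b [sa ma] [sb mb]; split; last exact: measurable_funM.
  apply: signature_functionalM => // g j; exact: pl_hat_piecewise_affine.
- by move=> a [].
- exact: compact_K.
- apply: measurable_sum => k; apply: measurable_sum => i.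
  exact: measurableT_comp.
- move=> N z Dz zN; split; first exact: tauTK.
  move=> j /=; case/mxvec_indexP: j => k i; apply: le_trans zN.
  rewrite (bigD1 k)//= (bigD1 i)//= -addrA lerDl addr_ge0//.
    by apply: sumr_ge0 => ? _.
  by do 2 (apply: sumr_ge0 => ? _).
- move=> N x [xT _]; apply: cvg_trans (cF xT); apply: cvg_app.
  by apply: within_subset => // -[t g] [].
- move=> N [t g] [t' g'] [/= tT _] [/= tT' _] sep.
  have t0T : 0 <= t <= T by have := TK0T tT; rewrite /= in_itv.
  have [tt pp] := generators_separate t0T sep; rewrite -tt.
  exact: Fsep.
- exact: mF.
- exact: iF.
have [N [l al]] := signature_functional_linear sa; exists N, l.
have aE z : D z -> a (Theta z) =
    linear_functional N l (signature (pl_hat (W z)) (tau z)).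
  by move=> Dz; rewrite al// tau_itv.
split.
  by apply: eq_measurable_fun ma => z /set_mem Dz; rewrite /= aE.
rewrite (eq_lp_dist _ _ (f' := F \o Theta) (g' := a \o Theta))//.
by move=> z /set_mem Dz; rewrite /= aE.
Qed.

End signature_density.

(** * Passage to the limit over the partitions *)

Section slab.
Variables (R : realType) (disp : measure_display) (Omega : measurableType disp).
Variables (P : probability Omega R) (T : R).
Local Notation leb := (@lebesgue_measure R).
Local Notation D := ([set` `[0%R, T]] `*` [set: Omega]).

Lemma measurable_slab : measurable (D : set (R * Omega)).
Proof. by apply: measurableX. Qed.

Lemma fubini_slab (phi : R * Omega -> \bar R) : measurable_fun D phi ->
  (forall z, D z -> 0 <= phi z)%E ->
  (\int[leb \x P]_(z in D) phi z =
   \int[P]_w \int[leb]_(t in [set` `[0%R, T]]) phi (t, w))%E.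
Proof.
move=> mphi phi0; rewrite integral_mkcond.
have mphiD : measurable_fun setT (phi \_ D).
  apply/(measurable_restrict _ measurable_slab measurableT).
  by rewrite setTI.
rewrite fubini_tonelli2//; last first.
  by move=> z; rewrite /patch; case: ifPn => // /set_mem /phi0.
apply: eq_integral => w _; rewrite [RHS]integral_mkcond /fubini_G.
apply: eq_integral => t _; rewrite /patch.
suff -> : ((t, w) \in D) = (t \in [set` `[0, T]]) by [].
by apply/idP/idP => /set_mem h; apply/mem_set; [case: h|].
Qed.

Lemma integral_slab (h : Omega -> R) : 0 <= T -> measurable_fun setT h ->
  (forall w, 0 <= h w) ->
  (\int[leb \x P]_(z in D) (h z.2)%:E = T%:E * \int[P]_w (h w)%:E)%E.
Proof.
move=> T0 mh h0; have mhE : measurable_fun setT (EFin \o h) by exact/measurable_EFinP.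
rewrite (@fubini_slab (fun z => (h z.2)%:E)); last 2 first.
- apply: measurable_funTS; apply: (measurableT_comp mhE).
  exact: measurable_snd.
- by move=> z _; rewrite lee_fin.
rewrite -ge0_integralZl//; last by move=> w _; rewrite lee_fin.
apply: eq_integral => w _ /=; rewrite (integral_cst _ _ (h w)%:E)//=.
rewrite lebesgue_measure_itv/= lte_fin oppr0 adde0 muleC.
have [//|T0'] := ltP 0 T; suff -> : T = 0 by [].
by apply/eqP; rewrite eq_le T0'.
Qed.

End slab.

Section approximation.
Variables (R : realType) (T p : R) (d : nat).
Variables (disp : measure_display) (Omega : measurableType disp).
Variables (P : probability Omega R) (X : Omega -> path_space T d).
Variable pi_ : nat -> partition_of T.
Hypothesis T0 : 0 < T.
Hypothesis p1 : 1 <= p.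
Hypothesis gX : gaussian_process P X.
Hypothesis X0 : forall w, ev (X w) 0 = 0.
Hypothesis mesh0 : mesh 0 (pi_ n) @[n --> \oo] --> (0 : R).
Local Notation leb := (@lebesgue_measure R).
Local Notation Xhat w := (time_ext (X w)).
Local Notation Xpi n w := (time_ext (interp (pi_ n) (X w))).
Local Notation W n w := (increments (pi_ n) (X w)).

Let Xpi_cvg w : Xpi n w @[n --> \oo] --> Xhat w.
Proof. exact: interp_cvg. Qed.

Let XpiE n w : Xpi n w = pl_hat (W n w).
Proof. by rewrite interp_pl_path. Qed.

Let mW n k i : measurable_fun setT (fun w => increment (W n w) k i).
Proof. exact: (gaussian_increment gX k i).1. Qed.

Let eW n (c : R) : 0 <= c -> (\int[P]_w
  (expR (c * (1 + \sum_k \sum_i `|increment (W n w) k i|)))%:E < +oo)%E.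
Proof.
by move=> c0; apply: (exp_momentsD (exp_moments_cst P ler01)
  (increments_exp_moments (pi_ n) gX)).2.2.
Qed.

(** The part common to both statements, with [h n] the functional along the n-th
interpolation and [lf n] the linear functionals of its signature: [vitali]
handles the passage from [f] to [h n], the density hypothesis the passage from
[h n] to [lf n]. *)
Let approximate (dS : measure_display) (S : measurableType dS)
    (mu : {measure set S -> \bar R}) (D : set S) (f : S -> R)
    (h : nat -> S -> R) (lf : nat -> nat -> (seq 'I_d.+1 -> R) -> S -> R) (e : R) :
  measurable D -> (mu D < +oo)%E ->
  (forall n, (h n \_ D) \in Lfun mu p%:E) ->
  uniformly_integrable mu (fun n z => `|((h n) \_ D) z| `^ p) ->
  (forall z, D z -> h n z @[n --> \oo] --> f z) ->
  (forall n e, 0 < e -> measurable_fun D (h n) ->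
    (\int[mu]_(z in D) (`|h n z| `^ p)%:E < +oo)%E ->
    exists N l, measurable_fun D (lf n N l) /\
      (lp_dist mu D p (h n) (lf n N l) < e%:E)%E) ->
  0 < e -> exists n0, forall n, (n0 <= n)%N -> exists N l,
    measurable_fun D (fun z => `|f z - lf n N l z| `^ p) /\
    (lp_dist mu D p f (lf n N l) < e%:E)%E.
Proof.
move=> mD muD hL hui hf dense e0.
have [eta eta0 chain] := lp_dist_chain mu p1 mD e0.
have mh n := (Lfun_restrict p1 mD (hL n)).1.
have mf : measurable_fun D f := measurable_fun_cvg mh hf.
have tail := uniformly_integrable_clamp p1 mD mh hui.
have [n0 Hn0] := vitali p1 mD muD mh mf hf tail eta0.
exists n0 => n n0n.
have [N [l [mlf hlf]]] := dense n eta eta0 (mh n) (Lfun_restrict p1 mD (hL n)).2.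
exists N, l; split.
  apply: (measurableT_comp (measurable_powR p)).
  by apply: measurableT_comp => //; exact: measurable_funB.
apply: (chain _ _ _ _ mf (mh n) (mh n) mlf (ltW (Hn0 n n0n)) _ (ltW hlf)).
by rewrite lp_distxx// lee_fin ltW.
Qed.

Lemma terminal_approximation (f : path_space T d.+1 -> R) (eps : R) :
  continuous f ->
  (forall n, (fun w => f (Xpi n w)) \in Lfun P p%:E) ->
  uniformly_integrable P (fun n w => `|f (Xpi n w)| `^ p) ->
  0 < eps -> exists n0 : nat, forall n, (n0 <= n)%N ->
    exists (N : nat) (l : seq 'I_d.+1 -> R),
      ('E_P[(fun w => `|f (Xhat w) -
          linear_functional N l (signature (Xpi n w) T)| `^ p)%R]
        < (eps `^ p)%:E)%E.
Proof.
move=> cf fL fui eps0; have e0 : 0 < eps `^ p by rewrite powR_gt0.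
have PT : (P setT < +oo)%E by rewrite (le_lt_trans (probability_le1 _ _)) ?ltry.
have hT n : ((fun w => f (Xpi n w)) \_ setT) = (fun w => f (Xpi n w)).
  exact: patch_setT.
have [||||n0 Hn0] := @approximate _ _ P setT (fun w => f (Xhat w))
  (fun n w => f (Xpi n w))
  (fun n N l w => linear_functional N l (signature (Xpi n w) T)) _
  measurableT PT _ _ _ _ e0.
- by move=> n; rewrite hT.
- by move: fui; congr uniformly_integrable; apply/funext => n; rewrite hT.
- by move=> w _; exact: continuous_seq cf (@Xpi_cvg w).
- move=> n e e'0 mh ih.
  have [||||||||||N [l Hl]] := @signature_density R _ Omega P setT p p1 measurableT PT
    T d (pi_ n) T0 (cst T) (fun w => W n w) [set T]
    (fun z => f (pl_hat z.2)) _ _ _ _ _ _ _ _ _ _ e e'0.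
  + exact: compact_set1.
  + by move=> _ ->; rewrite /= in_itv/= lexx ltW.
  + by [].
  + exact: measurable_cst.
  + exact: mW.
  + exact: eW.
  + move=> x _; apply: cvg_within_filter.
    apply: (@cvg_comp _ _ _ (fun z => pl_hat z.2) f); last exact: cf.
    apply: (@cvg_comp _ _ _ snd (@pl_hat R T d (pi_ n))); first exact: cvg_snd.
    exact: pl_hat_continuous.
  + move=> _ g g' -> gg'; congr f; exact: path_space_ext.
  + by move: mh; congr measurable_fun; apply/funext => w; rewrite XpiE.
  + by move: ih; under eq_integral do rewrite XpiE.
  exists N, l; move: Hl => /=.
  by under eq_fun do rewrite -XpiE; under [X in lp_dist _ _ _ X _]eq_fun do rewrite -XpiE.
exists n0 => n /Hn0[N [l [_ Hl]]]; exists N, l.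
by rewrite unlock.
Qed.

Lemma running_approximation (f : R -> path_space T d.+1 -> R) (eps : R) :
  {within [set` `[0, T]] `*` [set: path_space T d.+1],
    continuous (fun tx => f tx.1 tx.2)} ->
  non_anticipative f ->
  (forall n, ((fun tw => f tw.1 (Xpi n tw.2)) \_ ([set` `[0, T]] `*` setT) :
    R * Omega -> R) \in Lfun (leb \x P)%E p%:E) ->
  uniformly_integrable (leb \x P)%E (fun n tw =>
    `|((fun tw => f tw.1 (Xpi n tw.2)) \_ ([set` `[0, T]] `*` setT)) tw| `^ p) ->
  0 < eps -> exists n0 : nat, forall n, (n0 <= n)%N ->
    exists (N : nat) (l : seq 'I_d.+1 -> R),
      (\int[P]_w \int[leb]_(t in [set` `[0%R, T]])
          (`|f t (Xhat w) - linear_functional N l (signature (Xpi n w) t)|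
             `^ p)%R%:E
         < (eps `^ p)%:E)%E.
Proof.
move=> cf na fL fui eps0; have e0 : 0 < eps `^ p by rewrite powR_gt0.
have mD := @measurable_slab R _ Omega T.
pose D : set (R * Omega) := [set` `[0, T]] `*` setT.
have one_slab : ((leb \x P)%E D < +oo)%E.
  rewrite product_measure1E//= lebesgue_measure_itv/= lte_fin T0 oppr0 adde0.
  by rewrite lte_mul_pinfty ?lee_fin ?(ltW T0)// (le_lt_trans (probability_le1 _ _)) ?ltry.
have [||n0 Hn0] := @approximate _ _ (leb \x P)%E D
  (fun z => f z.1 (Xhat z.2)) (fun n z => f z.1 (Xpi n z.2))
  (fun n N l z => linear_functional N l (signature (Xpi n z.2) z.1)) _
  mD one_slab fL fui _ _ e0.
- move=> [t w] Dtw; apply: (@within_continuous_seq _ _ _ _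
    (fun n => (t, Xpi n w)) (t, Xhat w) cf).
  + by split => //; case: Dtw.
  + by move=> n; split => //; case: Dtw.
  + apply: (@cvg_pair _ _ _ \oo (nbhs t) (nbhs (Xhat w)) _ _ _ (fun=> t)).
      exact: cvg_cst.
    exact: (@Xpi_cvg w).
- move=> n e e'0 mh ih.
  have [||||||||||N [l Hl]] := @signature_density R _ _ (leb \x P)%E D p p1 mD one_slab
    T d (pi_ n) T0 fst (fun z => W n z.2) [set` `[0, T]]
    (fun z => f z.1 (pl_hat z.2)) _ _ _ _ _ _ _ _ _ _ e e'0.
  + exact: segment_compact.
  + by [].
  + by move=> z [].
  + by apply: measurable_funTS; exact: measurable_fst.
  + move=> k i; apply: measurable_funTS.
    by apply: (measurableT_comp (@mW n k i)); exact: measurable_snd.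
  + move=> c c0; have [me _] := increments_exp_moments (pi_ n) gX.
    have m1 : measurable_fun setT (fun w =>
        expR (c * (1 + \sum_k \sum_i `|increment (W n w) k i|))).
      apply: (measurableT_comp (@measurable_expR R)).
      apply: measurable_funM; first exact: measurable_cst.
      by apply: measurable_funD; [exact: measurable_cst|exact: me].
    rewrite (integral_slab P (ltW T0) m1) => [|w]; last exact: expR_ge0.
    by rewrite lte_mul_pinfty ?lee_fin ?(ltW T0)//; exact: eW.
  + move=> x x0T.
    have kc : continuous (fun z : R * 'rV[R]_(size (pi_ n) * d) =>
        (z.1, pl_hat z.2) : R * path_space T d.+1).
      move=> z; apply: (@cvg_pair _ _ _ (nbhs z) (nbhs z.1) (nbhs (pl_hat z.2))
        _ _ _ fst (fun z => pl_hat z.2)); first exact: cvg_fst.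
      apply: (@cvg_comp _ _ _ snd (@pl_hat R T d (pi_ n))); first exact: cvg_snd.
      exact: pl_hat_continuous.
    have kD (z : R * 'rV[R]_(size (pi_ n) * d)) :
      ([set` `[0, T]] `*` setT) z -> ([set` `[0, T]] `*` setT) (z.1, pl_hat z.2).
      by case.
    have Dx : ([set` `[0, T]] `*` [set: 'rV[R]_(size (pi_ n) * d)]) x by split.
    exact: (@within_composition_cvg _ _ _ _ _ _ _ x cf kc kD Dx).
  + by move=> t g g' /=; rewrite in_itv/= => t0T gg'; apply: na.
  + by move: mh; congr measurable_fun; apply/funext => w; rewrite XpiE.
  + by move: ih; under eq_integral do rewrite XpiE.
  exists N, l; move: Hl => /=.
  by under eq_fun do rewrite -XpiE; under [X in lp_dist _ _ _ X _]eq_fun do rewrite -XpiE.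
exists n0 => n /Hn0[N [l [ml Hl]]]; exists N, l.
move: Hl; rewrite /lp_dist fubini_slab//; exact/measurable_EFinP.
Qed.

End approximation.
Theorem proposition4p2 (R : realType) (T p rho alpha : R) (d : nat)
    (disp : measure_display) (Omega : measurableType disp)
    (P : probability Omega R)
    (X : Omega -> path_space T d) (pi_ : nat -> partition_of T) :
  0 < T -> (0 < d)%N -> 1 <= p -> 1 <= rho < 2 ->
  4%:R^-1 < alpha < (2%:R * rho)^-1 ->
  gaussian_process P X -> centred P X -> independent_components P X ->
  (forall w, ev (X w) 0 = 0) ->
  (exists M : R, forall (i : 'I_d) (s t : R), 0 <= s -> s <= t -> t <= T ->
     (covariance_variation P (component X i) rho s t s t
        <= (M * `|t - s| `^ rho^-1)%:E)%E) ->
  (forall n, {subset (pi_ n : seq R) <= (pi_ n.+1 : seq R)}) ->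
  mesh 0 (pi_ n) @[n --> \oo] --> (0 : R) ->
  let Xhat w := time_ext (X w) in
  let Xpi n w := time_ext (interp (pi_ n) (X w)) in
  (forall f : path_space T d.+1 -> R,
     measurable_fun setT
       (f : g_sigma_algebraType (@open (path_space T d.+1)) -> R) ->
     continuous f ->
     (forall n, (fun w => f (Xpi n w)) \in Lfun P p%:E) ->
     uniformly_integrable P (fun n w => `|f (Xpi n w)| `^ p) ->
     forall eps : R, 0 < eps -> exists n0 : nat, forall n, (n0 <= n)%N ->
       exists (N : nat) (l : seq 'I_d.+1 -> R),
         ('E_P[(fun w => `|f (Xhat w) -
                linear_functional N l (signature (Xpi n w) T)| `^ p)%R]
            < (eps `^ p)%:E)%E) /\
  (forall f : R -> path_space T d.+1 -> R,
     let D : set (R * g_sigma_algebraType (@open (path_space T d.+1))) :=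
       [set` `[0, T]] `*` setT in
     let Y n : R * Omega -> R :=
       (fun tw => f tw.1 (Xpi n tw.2)) \_ ([set` `[0, T]] `*` setT) in
     measurable_fun D (fun tx => f tx.1 tx.2) ->
     {within [set` `[0, T]] `*` [set: path_space T d.+1],
        continuous (fun tx => f tx.1 tx.2)} ->
     non_anticipative f ->
     (forall n, Y n \in Lfun (lebesgue_measure \x P)%E p%:E) ->
     uniformly_integrable (lebesgue_measure \x P)%E
       (fun n tw => `|Y n tw| `^ p) ->
     forall eps : R, 0 < eps -> exists n0 : nat, forall n, (n0 <= n)%N ->
       exists (N : nat) (l : seq 'I_d.+1 -> R),
         (\int[P]_w \int[lebesgue_measure]_(t in [set` `[0%R, T]])
             (`|f t (Xhat w) - linear_functional N l (signature (Xpi n w) t)|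
                `^ p)%R%:E
            < (eps `^ p)%:E)%E).
Proof.
move=> T0 _ p1 _ _ gX _ _ X0 _ _ mesh0 Xhat Xpi; split.
  move=> f _ cf fL fui eps eps0.
  exact: (terminal_approximation T0 p1 gX X0 mesh0 cf fL fui eps0).
move=> f D Y _ cf na fL fui eps eps0.
exact: (running_approximation T0 p1 gX X0 mesh0 cf na fL fui eps0).
Qed.
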